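(* There is a (randomized) $1/e$-competitive online algorithm for online unconstrained submodular maximization with preemption. Moreover, it can be implemented in polynomial time at the cost of an $\varepsilon$ loss in the competitive ratio: for every constant $\varepsilon>0$ there is a polynomial time $(1/e-\varepsilon)$-competitive online algorithm for this model.
   Context: Online unconstrained submodular maximization with preemption (the unconstrained model): there is an unknown finite ground set $\mathcal N=\{u_1,\dots,u_n\}$ and a non-negative submodular function $f:2^{\mathcal N}\to\mathbb R_{\ge 0}$ (not necessarily monotone). The elements are revealed one by one in the order $u_1,\dots,u_n$, chosen by an adversary. The algorithm does not know $n$ in advance. It maintains solutions $S_0=\varnothing,S_1,\dots,S_n$, where immediately after $u_i$ is revealed it chooses (possibly at random) $S_i$ to be any subset of $S_{i-1}\cup\{u_i\}$ (previously accepted elements may be dropped, but dropped or rejected elements cannot return). The choice may depend only on the values of $f$ on subsets of $\{u_1,\dots,u_i\}$ (accessed through a value oracle), the past, and internal randomness. Every subset of $\mathcal N$ is feasible. The algorithm is $\alpha$-competitive if $\mathbb E[f(S_n)]\ge\alpha\cdot\max_{S\subseteq\mathcal N}f(S)$ for every instance. Polynomial time means that the number of elementary operations and value oracle queries is polynomial in the number of elements revealed (for fixed $\varepsilon$), where drawing a uniformly random number from $[0,1]$ and arithmetic operations/comparisons on numbers count as elementary operations. *)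

(* Defs.v *)
From HB Require Import structures.
From mathcomp Require Import all_boot all_order all_algebra.
From mathcomp Require Import all_classical all_reals all_analysis.

Set Implicit Arguments.
Unset Strict Implicit.
Unset Printing Implicit Defensive.

Import Order.TTheory GRing.Theory Num.Theory.

Local Open Scope ring_scope.

(* An instance is a function f : {set 'I_n} -> R; the element j : 'I_n is the
   (j+1)-st one to be revealed, so that the adversary's choice of the order is
   part of the choice of f. *)

Definition nonnegative (R : realType) (n : nat) (f : {set 'I_n} -> R) : Prop :=
  forall A : {set 'I_n}, 0 <= f A.

Definition submodular (R : realType) (n : nat) (f : {set 'I_n} -> R) : Prop :=
  forall A B : {set 'I_n}, f (A :|: B) + f (A :&: B) <= f A + f B.

(* The set of those elements of 'I_n whose index occurs in T; used with i <= n,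
   where it is the image of T under the inclusion of 'I_i in 'I_n. *)
Definition embed (i n : nat) (T : {set 'I_i}) : {set 'I_n} :=
  [set j : 'I_n | [exists k in T, k == j :> nat]].

(* What is known of f once the first i elements have been revealed. *)
Definition revealed (R : realType) (n : nat) (f : {set 'I_n} -> R) (i : nat) :
  {set 'I_i} -> R := fun T => f (embed n T).
Arguments revealed {R n} f i T.

(* A randomized online algorithm: immediately after the i-th element has been
   revealed, it names the set of elements that it wants to hold, as a function
   of the values of f on the subsets of the first i elements and of a sequence
   of random numbers. The total number n of elements is not available to it.
   The earlier solutions are functions of the same data. *)
Definition online_algorithm (R : realType) : Type :=
  forall i : nat, ({set 'I_i} -> R) -> (nat -> R) -> {set 'I_i}.

(* The solution S_i. Intersecting with the candidates S_(i-1) + u_i makes sure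
   that an element that has been dropped or rejected never returns, and allows
   every subset of the candidates as the next solution. *)
Fixpoint solution (R : realType) (A : online_algorithm R) (n : nat)
    (f : {set 'I_n} -> R) (tape : nat -> R) (i : nat) : {set 'I_n} :=
  if i is i'.+1 then
    (solution A f tape i' :|: [set j : 'I_n | j == i' :> nat])
      :&: embed n (A i (revealed f i) tape)
  else finset.set0.

Definition iid_uniform (R : realType) (d : measure_display)
    (Omega : measurableType d) (P : probability Omega R)
    (U : nat -> {RV P >-> R}) : Prop :=
  (forall (k : nat) (B : set R), measurable B ->
     P (U k @^-1` B)%classic = uniform_prob (@ltr01 R) B) /\
  (forall (N : nat) (B : nat -> set R), (forall k, measurable (B k)) ->
     P (\bigcap_(k < N) (U k @^-1` B k))%classic =
     (\prod_(k < N) P (U k @^-1` B k)%classic)%E).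

(* The source of randomness is any sequence of independent uniform numbers in
   [0, 1]; the law of S_n does not depend on the space that carries it. *)
Definition competitive (R : realType) (alpha : R) (A : online_algorithm R) :
    Prop :=
  forall (d : measure_display) (Omega : measurableType d)
         (P : probability Omega R) (U : nat -> {RV P >-> R}),
  iid_uniform U ->
  forall (n : nat) (f : {set 'I_n} -> R), nonnegative f -> submodular f ->
  let Sn := fun w : Omega => solution A f (fun k => U k w) n in
  (forall T : {set 'I_n}, measurable [set w | Sn w = T]%classic) /\
  ((alpha * \big[Num.max/f finset.set0]_(T : {set 'I_n}) f T)%:E
     <= 'E_P[fun w => f (Sn w)])%E.

(* A random access machine over the reals. Its memory consists of arrays of
   natural numbers (used for indices, counters and sets) and arrays of real
   numbers; an array is named by a natural number fixed in the program text,
   and a scalar variable is the cell 0 of an array. Naturals and reals have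
   unit cost arithmetic and comparisons; there are no real constants besides
   naturals, no rounding of reals and no division of naturals. *)

Inductive nexpr : Type :=
  | NConst of nat
  | NCell of nat & nexpr
  | NAdd of nexpr & nexpr
  | NSub of nexpr & nexpr (* truncated *)
  | NMul of nexpr & nexpr.

Inductive rexpr : Type :=
  | RNat of nexpr
  | RCell of nat & nexpr
  | RAdd of rexpr & rexpr
  | RSub of rexpr & rexpr
  | RMul of rexpr & rexpr
  | RDiv of rexpr & rexpr.

Inductive bexpr : Type :=
  | BNle of nexpr & nexpr
  | BRle of rexpr & rexpr
  | BNot of bexpr
  | BAnd of bexpr & bexpr.

Inductive prog : Type :=
  | Skip
  | NSet of nat & nexpr & nexpr  (* NSet a i e : a[i] := e *)
  | RSet of nat & nexpr & rexpr  (* RSet a i e : a[i] := e *)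
  | Draw of nat & nexpr          (* Draw a i : a[i] := fresh uniform number *)
  | Query of nat & nexpr & nat   (* Query a i b : a[i] := f {u_j | b[j] != 0} *)
  | Seq of prog & prog
  | If of bexpr & prog & prog
  | For of nat & nexpr & prog.   (* For a e p : for a[0] = 0, ..., e - 1 do p,
                                    where e is evaluated once *)

Record state (R : realType) : Type := State {
  ncell : nat -> nat -> nat;
  rcell : nat -> nat -> R;
  drawn : nat;  (* how many random numbers have been drawn *)
  steps : nat   (* how many elementary operations and queries were made *)
}.

Definition init (R : realType) : state R :=
  State (fun _ _ => 0%N) (fun _ _ => 0) 0 0.

Definition upd (T : Type) (m : nat -> nat -> T) (a i : nat) (x : T) :
    nat -> nat -> T :=
  fun a' i' => if (a' == a) && (i' == i) then x else m a' i'.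

Definition tick (R : realType) (c : nat) (st : state R) : state R :=
  State (ncell st) (rcell st) (drawn st) (steps st + c).

Definition nset (R : realType) (a i x : nat) (st : state R) : state R :=
  State (upd (ncell st) a i x) (rcell st) (drawn st) (steps st).

Definition rset (R : realType) (a i : nat) (x : R) (st : state R) : state R :=
  State (ncell st) (upd (rcell st) a i x) (drawn st) (steps st).

Definition advance (R : realType) (st : state R) : state R :=
  State (ncell st) (rcell st) (drawn st).+1 (steps st).

Section Semantics.
Variable R : realType.
Implicit Type st : state R.

Fixpoint neval st (e : nexpr) : nat :=
  match e with
  | NConst k => k
  | NCell a e => ncell st a (neval st e)
  | NAdd e1 e2 => (neval st e1 + neval st e2)%N
  | NSub e1 e2 => (neval st e1 - neval st e2)%N
  | NMul e1 e2 => (neval st e1 * neval st e2)%N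
  end.

Fixpoint reval st (e : rexpr) : R :=
  match e with
  | RNat e => (neval st e)%:R
  | RCell a e => rcell st a (neval st e)
  | RAdd e1 e2 => reval st e1 + reval st e2
  | RSub e1 e2 => reval st e1 - reval st e2
  | RMul e1 e2 => reval st e1 * reval st e2
  | RDiv e1 e2 => reval st e1 / reval st e2
  end.

Fixpoint beval st (b : bexpr) : bool :=
  match b with
  | BNle e1 e2 => (neval st e1 <= neval st e2)%N
  | BRle e1 e2 => reval st e1 <= reval st e2
  | BNot b => ~~ beval st b
  | BAnd b1 b2 => beval st b1 && beval st b2
  end.

(* Evaluating an expression costs one unit for each of its nodes. *)
Fixpoint ncost (e : nexpr) : nat :=
  match e with
  | NConst _ => 1
  | NCell _ e => (ncost e).+1
  | NAdd e1 e2 | NSub e1 e2 | NMul e1 e2 => (ncost e1 + ncost e2).+1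
  end.

Fixpoint rcost (e : rexpr) : nat :=
  match e with
  | RNat e | RCell _ e => (ncost e).+1
  | RAdd e1 e2 | RSub e1 e2 | RMul e1 e2 | RDiv e1 e2 =>
      (rcost e1 + rcost e2).+1
  end.

Fixpoint bcost (b : bexpr) : nat :=
  match b with
  | BNle e1 e2 => (ncost e1 + ncost e2).+1
  | BRle e1 e2 => (rcost e1 + rcost e2).+1
  | BNot b => (bcost b).+1
  | BAnd b1 b2 => (bcost b1 + bcost b2).+1
  end.

(* The value oracle takes the indicator of the queried set. *)
Fixpoint exec (oracle : pred nat -> R) (tape : nat -> R) (p : prog) st :
    state R :=
  match p with
  | Skip => tick 1 st
  | NSet a i e =>
      tick (ncost i + ncost e).+1 (nset a (neval st i) (neval st e) st)
  | RSet a i e =>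
      tick (ncost i + rcost e).+1 (rset a (neval st i) (reval st e) st)
  | Draw a i =>
      tick (ncost i).+1 (advance (rset a (neval st i) (tape (drawn st)) st))
  | Query a i b =>
      tick (ncost i).+1
        (rset a (neval st i) (oracle (fun j => ncell st b j != 0%N)) st)
  | Seq p1 p2 => exec oracle tape p2 (exec oracle tape p1 st)
  | If b p1 p2 =>
      let st' := tick (bcost b).+1 st in
      if beval st b then exec oracle tape p1 st' else exec oracle tape p2 st'
  | For a e p1 =>
      foldl (fun s k => exec oracle tape p1 (tick 1 (nset a 0 k s)))
            (tick (ncost e).+1 st) (iota 0 (neval st e))
  end.

(* The memory after the first i elements of f have been revealed. The program
   is executed once upon each arrival, on the memory left by the previous
   execution; while only i elements are known, queries concern these only. *)
Fixpoint run (p : prog) (n : nat) (f : {set 'I_n} -> R) (tape : nat -> R)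
    (i : nat) : state R :=
  if i is i'.+1 then
    exec (fun b => f [set j : 'I_n | (j < i)%N && b j]) tape p
         (run p f tape i')
  else init R.

(* The set that the program wants to hold is read in the natural array 0. *)
Definition algorithm_of (p : prog) : online_algorithm R :=
  fun i v tape => [set j : 'I_i | ncell (run p v tape i) 0 j != 0%N].

(* A prefix of an instance is an instance, hence the bound holds after each
   arrival, with n the number of elements revealed so far. *)
Definition polynomial_time (p : prog) : Prop :=
  exists q : {poly nat},
  forall (n : nat) (f : {set 'I_n} -> R), nonnegative f -> submodular f ->
  forall tape : nat -> R, (forall k, 0 <= tape k <= 1) ->
  (steps (run p f tape n) <= q.[n])%N.

End Semantics.

(* Main.v *)
(* Every element u gets an independent uniform key, and those with a key below
   p compete. Let W be the set of all elements ever accepted, also those dropped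
   later: upon arrival u enters W iff its marginal with respect to the elements
   of W with a smaller key is positive. The solution S consists of those v in W
   whose marginal with respect to the elements of W with a smaller key is still
   positive. W only grows with the arrivals, so marginals with respect to W only
   decrease, hence no dropped element is missed: for each threshold x, an element
   of the optimum O with key below x is in W or has a nonpositive marginal with
   respect to W(x), the elements of W with key below x. An element with key above
   x has a key uniform in [x, 1] given W(x), so that
     (1 - x) (d/dx) E f(S(x)) >= E f(O u W(x)) - E f(W(x)).
   Moreover f(W(x)) <= f(S(x)), and E f(O u W(x)) >= (1 - x) f(O) because W(x)
   contains no element with probability above x. The differential inequality
   yields E f(S) >= q ln(1/q) f(O) for q = 1 - p, which is f(O) / e for q = 1/e.
   It is established in discrete form, with keys rounded to M values and ties
   broken by arrival; real keys behave in the same way unless two of them (or one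
   of them and p) round to the same value, and M tends to infinity. The random
   access machine runs this algorithm with a rational p. *)

Require Import Defs.
From mathcomp Require Import all_boot all_order all_algebra.
From mathcomp Require Import all_classical all_reals all_analysis.
From mathcomp Require Import measurable_realfun fintype finset zify ring lra.

Set Implicit Arguments.
Unset Strict Implicit.
Unset Printing Implicit Defensive.

Import Order.TTheory GRing.Theory Num.Theory.

Local Open Scope ring_scope.

(** * Marginals of a submodular function *)

Section Submodular.
Variables (R : realType) (n : nat).
Implicit Types (f : {set 'I_n} -> R) (X Y O : {set 'I_n}) (i j : 'I_n).

Definition marginal f j X := f (j |: X) - f X.

Lemma marginal_in f j X : j \in X -> marginal f j X = 0.
Proof.
move=> jX; rewrite /marginal (_ : j |: X = X) ?subrr //.
by apply/setUidPr; rewrite sub1set.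
Qed.

(** Submodularity for the pair [j |: X], [Y]: since [j \notin Y], their intersection is just [X]. *)
Lemma marginal_le f j X Y : submodular f -> X \subset Y -> j \notin Y ->
  marginal f j Y <= marginal f j X.
Proof.
move=> sf XY jY; have := sf (j |: X) Y.
have -> : (j |: X) :|: Y = j |: Y by rewrite -setUA (setUidPr XY).
have -> : (j |: X) :&: Y = X.
  rewrite setIUl (setIidPl XY).
  have -> : [set j] :&: Y = set0.
    by apply/eqP; rewrite setI_eq0 disjoints1.
  by rewrite set0U.
rewrite /marginal; lra.
Qed.

(** Unlike the full comparison of marginals, the sign also passes on when [j \in Y], because the
    marginal is then zero. *)
Lemma marginal_le0 f j X Y : submodular f -> X \subset Y ->
  marginal f j X <= 0 -> marginal f j Y <= 0.
Proof.
move=> sf XY; case: (boolP (j \in Y)) => jY; first by rewrite (marginal_in f jY).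
by apply: le_trans; apply: marginal_le.
Qed.

(** The elements of [O] join [Y] one at a time; each meets a superset of [Y], where its marginal is
    no larger than over [Y]. *)
Lemma submodular_setU_le f O Y : submodular f ->
  f (O :|: Y) - f Y <= \sum_(i in O) marginal f i Y.
Proof.
move=> sf; have [m] := ubnP #|O|; elim: m O => // m IH O Om.
have [->|[i iO]] := set_0Vmem O; first by rewrite big_set0 set0U subrr.
rewrite (big_setD1 i) //= -{1}(setD1K iO) -setUA.
have OD : (#|O :\ i| < m)%N by move: Om; rewrite (cardsD1 i O) iO.
have : marginal f i (O :\ i :|: Y) <= marginal f i Y.
  case: (boolP (i \in Y)) => iY.
    by rewrite !marginal_in // in_setU iY orbT.
  by apply: marginal_le; rewrite ?subsetUr // !inE eqxx.
have := IH _ OD; rewrite {2}/marginal; lra.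
Qed.

End Submodular.

(** * Uncrossing, and the loss caused by a random set *)

Section UncrossingChain.
Variables (T : finType) (R : realType) (g : {set T} -> R).

(* Uncrossing inserts a set into a decreasing chain; iterated, it turns a
   family into a chain with the same multiplicity at every point. *)
Fixpoint uncross (X : {set T}) (s : seq {set T}) : seq {set T} :=
  if s is Y :: s' then (X :|: Y) :: uncross (X :&: Y) s' else [:: X].

Definition chain (s : seq {set T}) := foldr uncross [::] s.

Lemma size_chain s : size (chain s) = size s.
Proof.
elim: s => //= X s <-; elim: (chain s) X => //= Y s' IH X; by rewrite IH.
Qed.

Lemma count_chain s x :
  count (fun X : {set T} => x \in X) (chain s) = count (fun X : {set T} => x \in X) s.
Proof.
elim: s => //= X s <-; elim: (chain s) X => //= Y s' IH X.
by rewrite IH !inE; case: (x \in X); case: (x \in Y) => /=; lia.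
Qed.

Lemma chain_path s (Z : {set T}) : all (fun X : {set T} => X \subset Z) s ->
  path (fun X Y : {set T} => Y \subset X) Z (chain s).
Proof.
elim: s => //= X s IH /andP[XZ /IH]; elim: (chain s) X Z XZ {IH} => /= [|Y s' IH] X Z XZ.
  by rewrite XZ.
case/andP=> YZ p; rewrite subUset XZ YZ /=; apply: IH.
  exact: subset_trans (subsetIl X Y) (subsetUl X Y).
by case: s' p => //= W s' /andP[WY ->]; rewrite (subset_trans WY) ?subsetUr.
Qed.

Lemma sum_chain_le s :
  (forall X Y, g (X :|: Y) + g (X :&: Y) <= g X + g Y) ->
  \sum_(X <- chain s) g X <= \sum_(X <- s) g X.
Proof.
move=> sg; elim: s => [|X s IH] /=; first by rewrite !big_nil.
rewrite big_cons; apply: (@le_trans _ _ (g X + \sum_(X <- chain s) g X)); last first.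
  by rewrite lerD2l.
elim: (chain s) X {IH} => /= [|Y s' IH] X; first by rewrite !big_cons !big_nil.
by rewrite !big_cons; have := IH (X :&: Y); have := sg X Y; lra.
Qed.

(** The nonempty members of a decreasing chain share a point, so the multiplicity bound at that
    point limits their number. All other members contribute [g set0] each. *)
Lemma chain_sum_ge s (Z : {set T}) (a b : nat) :
  (forall X, 0 <= g X) -> (b <= a)%N ->
  path (fun X Y : {set T} => Y \subset X) Z s ->
  (forall x, a * count (fun X : {set T} => x \in X) s <= b * size s)%N ->
  (a - b)%:R * (size s)%:R * g set0 <= a%:R * \sum_(X <- s) g X.
Proof.
move=> g0 ba ps cnt.
have cmono s' W : path (fun X Y : {set T} => Y \subset X) W s' ->
    all (fun X : {set T} => X \subset W) s'.
  elim: s' W => //= X s' IH W /andP[XW /IH] /allP al.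
  by rewrite XW; apply/allP => Y /al YX; apply: subset_trans YX XW.
pose N := count (fun X : {set T} => X != set0) s.
(* The point comes from the last nonempty member of the chain; [None] stands for a chain of empty
   sets. *)
have [x cx] : exists x : option T, (N <= if x is Some x then
    count (fun X : {set T} => x \in X) s else 0)%N.
  rewrite /N; elim: s Z {cnt N} ps => [|X s IH] W /=; first by exists None.
  case/andP=> XW ps; have [X0|[y yX]] := set_0Vmem X.
    exists None; rewrite X0 eqxx add0n leqn0.
    apply/eqP/eqP; rewrite -leqn0 leqNgt -has_count -all_predC.
    apply/allP => Y Ys /=; rewrite negbK -subset0 -X0.
    by move/allP: (cmono _ _ ps) => /(_ _ Ys).
  have [[x|] cx] := IH _ ps; last first.
    by exists (Some y); rewrite yX; case: (X != _) => /=; lia.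
  case: (posnP (count (fun Y : {set T} => x \in Y) s)) => [c0|].
    by exists (Some y); rewrite yX; case: (X != _) => /=; lia.
  rewrite -has_count => /hasP[Y Ys xY]; exists (Some x).
  move/allP: (cmono _ _ ps) => /(_ _ Ys) /subsetP /(_ _ xY) ->.
  by case: (X != _) => /=; lia.
have aN : (a * N <= b * size s)%N.
  case: x cx => [x|] cx; last by move: cx; rewrite leqn0 => /eqP ->; rewrite muln0.
  by apply: leq_trans (cnt x); rewrite leq_mul2l cx orbT.
have sumge : (size s - N)%:R * g set0 <= \sum_(X <- s) g X.
  have -> : (size s - N = count (pred1 set0) s)%N.
    by rewrite -(count_predC (pred1 set0)) addnK.
  elim: (s) => [|X s' IH] /=; first by rewrite big_nil mul0r.
  rewrite big_cons natrD mulrDl; apply: lerD => //.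
  by case: eqP => [->|_]; rewrite ?mul1r ?mul0r.
apply: (@le_trans _ _ (a%:R * ((size s - N)%:R * g set0))); last first.
  by rewrite ler_wpM2l.
rewrite mulrA ler_wpM2r // -!natrM ler_nat.
have := count_size (fun X : {set T} => X != set0) s.
by rewrite -/N !mulnBl !mulnBr; nia.
Qed.

(* The sets may be correlated: it only matters that each point lies in at most
   a fraction [b / a] of them. *)
Lemma sum_submodular_ge (s : seq {set T}) (a b : nat) :
  (forall X, 0 <= g X) ->
  (forall X Y, g (X :|: Y) + g (X :&: Y) <= g X + g Y) -> (b <= a)%N ->
  (forall x, a * count (fun X : {set T} => x \in X) s <= b * size s)%N ->
  (a - b)%:R * (size s)%:R * g set0 <= a%:R * \sum_(X <- s) g X.
Proof.
move=> g0 sg ba cnt.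
apply: (@le_trans _ _ (a%:R * \sum_(X <- chain s) g X)); last first.
  by rewrite ler_wpM2l // sum_chain_le.
rewrite -size_chain; apply: (@chain_sum_ge _ setT) => //.
  by apply: chain_path; apply/allP => X _; apply: subsetT.
by move=> x; rewrite count_chain size_chain.
Qed.

End UncrossingChain.

(** * The greedy process for an arbitrary order *)

Section Process.
Variables (R : realType) (n : nat) (f : {set 'I_n} -> R).
Variables (lt : rel nat) (mark : pred nat).

(** The order [lt] stays abstract because the process is used both with real keys and with integer
    ranks. *)
Definition below (W : {set 'I_n}) (j : nat) := [set l in W | lt l j].

(* The elements that have been accepted by time [i]: they stay here when the
   solution drops them, and every decision is based on these sets only. *)
Fixpoint accepted (i : nat) : {set 'I_n} :=
  if i is i'.+1 then
    accepted i' :|: [set j : 'I_n | [&& j == i' :> nat, mark j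
      & 0 < marginal f j (below (accepted i') j)]]
  else set0.

Definition kept (i : nat) : {set 'I_n} :=
  [set j in accepted i | 0 < marginal f j (below (accepted i) j)].

Lemma accepted_mem i j : j \in accepted i =
  [&& (j < i)%N, mark j & 0 < marginal f j (below (accepted j) j)].
Proof.
elim: i => [|i IH] /=; first by rewrite inE.
rewrite in_setU IH inE ltnS; case: ltngtP => // [ji|ji].
  by rewrite /= orbF.
by rewrite /= ji.
Qed.

Lemma accepted_restrict i i' : (i <= i')%N ->
  accepted i = [set j in accepted i' | (j < i)%N].
Proof.
move=> ii'; apply/setP => j; rewrite inE !accepted_mem.
by case: (ltnP j i) => ji; rewrite ?andbF // andbT (leq_trans ji ii').
Qed.

Lemma accepted_sub i i' : (i <= i')%N -> accepted i \subset accepted i'.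
Proof.
by move=> /accepted_restrict ->; apply/subsetP => j; rewrite inE => /andP[].
Qed.

Lemma below_sub (X Y : {set 'I_n}) j : X \subset Y -> below X j \subset below Y j.
Proof.
move=> /subsetP XY; apply/subsetP => l; rewrite !inE => /andP[/XY -> ->].
by [].
Qed.

Lemma kept_sub i : kept i \subset accepted i.
Proof. by apply/subsetP => j; rewrite inE => /andP[]. Qed.

Hypothesis lt_irr : irreflexive lt.

Lemma below_notin (X : {set 'I_n}) (j : 'I_n) : j \notin below X j.
Proof. by rewrite !inE lt_irr andbF. Qed.

Hypothesis sf : submodular f.

(** Legality under preemption: as [accepted] grows, marginals decrease, so what is kept after an
    arrival was kept before it or has just arrived. *)
Lemma kept_next i :
  kept i.+1 \subset kept i :|: [set j : 'I_n | j == i :> nat].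
Proof.
apply/subsetP => j; rewrite [j \in kept _]inE => /andP[ji mj].
rewrite in_setU [j \in [set _ | _]]inE inE.
move: (ji); rewrite /= in_setU inE => /orP[ji'|/and3P[-> _ _]]; last by rewrite orbT.
rewrite ji' (lt_le_trans mj) //; apply: marginal_le; rewrite ?below_notin //.
exact/below_sub/(accepted_sub (leqnSn i)).
Qed.

(** A positive marginal over the final set forces a positive one over the smaller set seen on
    arrival, so the acceptance test is implied. *)
Lemma kept_mem (j : 'I_n) :
  (j \in kept n) = mark j && (0 < marginal f j (below (accepted n) j)).
Proof.
rewrite inE accepted_mem ltn_ord /=; case: (mark j) => //=.
case: (ltP 0 (marginal f j (below (accepted n) j))) => [m0|]; rewrite ?andbF ?andbT //.
rewrite (lt_le_trans m0) //; apply: marginal_le; rewrite ?below_notin //.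
by apply/below_sub/accepted_sub/ltnW.
Qed.

Lemma marginal_not_accepted (j : 'I_n) : mark j -> j \notin accepted n ->
  marginal f j (below (accepted n) j) <= 0.
Proof.
move=> mj; rewrite accepted_mem ltn_ord mj /= -leNgt; apply: marginal_le0 => //.
by apply/below_sub/accepted_sub/ltnW.
Qed.

End Process.

(** Lets rounded keys replace real ones as soon as all comparisons agree. *)
Lemma eq_accepted (R : realType) (n : nat) (f : {set 'I_n} -> R)
    (lt lt' : rel nat) (mark mark' : pred nat) i :
  (forall j l : 'I_n, lt j l = lt' j l) -> (forall j : 'I_n, mark j = mark' j) ->
  accepted f lt mark i = accepted f lt' mark' i.
Proof.
move=> elt em; elim: i => //= i ->; congr (_ :|: _); apply/setP => j.
rewrite !inE em; congr [&& _, _ & 0 < marginal f j _].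
by apply/setP => l; rewrite !inE elt.
Qed.

Lemma eq_kept (R : realType) (n : nat) (f : {set 'I_n} -> R)
    (lt lt' : rel nat) (mark mark' : pred nat) i :
  (forall j l : 'I_n, lt j l = lt' j l) -> (forall j : 'I_n, mark j = mark' j) ->
  kept f lt mark i = kept f lt' mark' i.
Proof.
move=> elt em; rewrite /kept (eq_accepted f i elt em); apply/setP => j.
by rewrite !inE; congr (_ && (0 < marginal f j _)); apply/setP => l; rewrite !inE elt.
Qed.

(** * Rank prefixes of the accepted and kept sets *)

Section Ranked.
Variables (R : realType) (n : nat) (f : {set 'I_n} -> R).
Variables (rk : nat -> nat) (mark : pred nat).
Hypothesis sf : submodular f.
Hypothesis rk_inj : forall i j : 'I_n, rk i = rk j -> i = j.

Let lt : rel nat := relpre rk ltn.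
Let W := accepted f lt mark n.
Let S := kept f lt mark n.

Definition upto (X : {set 'I_n}) p := [set j in X | (rk j < p)%N].

Let lt_irr : irreflexive lt. Proof. by move=> x; rewrite /lt /= ltnn. Qed.

Lemma upto0 X : upto X 0 = set0.
Proof. by apply/setP => j; rewrite !inE andbF. Qed.

Lemma uptoS X p : upto X p.+1 = upto X p \/
  exists j, [/\ j \in X, rk j = p & upto X p.+1 = j |: upto X p].
Proof.
case: (pickP [pred j in X | rk j == p]) => [j /andP[jX /eqP rj]|no]; [right|left].
  exists j; split => //; apply/setP => l; rewrite !inE ltnS leq_eqVlt -rj.
  case: (altP (l =P j)) => [->|lj]; first by rewrite jX eqxx.
  suff -> : (rk l == rk j) = false by [].
  by apply/negP => /eqP /rk_inj /eqP; rewrite (negbTE lj).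
apply/setP => l; rewrite !inE ltnS leq_eqVlt; have := no l; rewrite /= .
by case: (l \in X) => //= ->.
Qed.

Lemma upto_sub (X Y : {set 'I_n}) p : X \subset Y -> upto X p \subset upto Y p.
Proof. by move=> /subsetP XY; apply/subsetP => l; rewrite !inE => /andP[/XY -> ->]. Qed.

Lemma upto_le X p p' : (p <= p')%N -> upto X p \subset upto X p'.
Proof.
move=> pp; apply/subsetP => l; rewrite !inE => /andP[-> /leq_trans ->] //.
Qed.

(** Induction on the rank. An accepted element that is kept gains at least as much over the smaller
    prefix of [S]; one that is not kept has a nonpositive marginal and cannot raise the left
    side. *)
Lemma upto_accepted_le p : f (upto W p) <= f (upto S p).
Proof.
elim: p => [|p IH]; first by rewrite !upto0.
have SW : S \subset W by apply: kept_sub.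
have [EW|[j [jW rj EW]]] := uptoS W p.
  suff -> : upto S p.+1 = upto S p by rewrite EW.
  have [//|[j [jS rj ES]]] := uptoS S p.
  have : j \in upto W p.+1 by rewrite inE (subsetP SW) //= rj.
  by rewrite EW inE rj ltnn andbF.
have Eb : below lt W j = upto W p by apply/setP => l; rewrite !inE /lt /= rj.
have jp : j \notin upto S p by rewrite inE rj ltnn andbF.
have jpW : j \notin upto W p by rewrite inE rj ltnn andbF.
have mWS : marginal f j (upto W p) <= marginal f j (upto S p).
  by apply: marginal_le => //; apply: upto_sub.
case: (boolP (j \in S)) => jS.
  have -> : upto S p.+1 = j |: upto S p.
    have [ES|[j' [_ rj' ->]]] := uptoS S p; last first.
      by rewrite (rk_inj (etrans rj' (esym rj))).
    by move: jp; rewrite -ES inE jS rj leqnn.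
  rewrite EW; move: mWS IH; rewrite /marginal; lra.
have -> : upto S p.+1 = upto S p.
  have [//|[j' [j'S rj' _]]] := uptoS S p.
  by move: jS; rewrite (rk_inj (etrans rj (esym rj'))) j'S.
have : marginal f j (upto W p) <= 0.
  by move: jS; rewrite /S inE jW -/W Eb /= -leNgt.
rewrite EW /marginal; move: IH; lra.
Qed.

Lemma kept_gain (i : 'I_n) : i \in S ->
  marginal f i (upto W (rk i)) <= f (upto S (rk i).+1) - f (upto S (rk i)).
Proof.
move=> iS; have -> : upto S (rk i).+1 = i |: upto S (rk i).
  have [ES|[j [_ rj ->]]] := uptoS S (rk i); last by rewrite (rk_inj rj).
  have : i \in upto S (rk i).+1 by rewrite inE iS /=.
  by rewrite ES inE ltnn andbF.
apply: marginal_le => //; last by rewrite inE ltnn andbF.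
exact/upto_sub/kept_sub.
Qed.

Lemma below_upto (i : 'I_n) : below lt W i = upto W (rk i).
Proof. by apply/setP => l; rewrite !inE. Qed.

Lemma kept_upto (i : 'I_n) :
  (i \in S) = mark i && (0 < marginal f i (upto W (rk i))).
Proof. by rewrite kept_mem // -/W below_upto. Qed.

Lemma kept_le p : f (upto S p) <= f (upto S p.+1).
Proof.
have [->//|[j [jS rj _]]] := uptoS S p.
have := kept_gain jS; rewrite rj; move: jS.
rewrite kept_upto rj => /andP[_ m0]; lra.
Qed.

(** If [i] is not kept, the maximum is 0, and the right side is nonnegative because [f] increases
    along the prefixes of [S]. *)
Lemma kept_gain_max (i : 'I_n) : mark i ->
  Num.max 0 (marginal f i (upto W (rk i))) <=
  f (upto S (rk i).+1) - f (upto S (rk i)).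
Proof.
move=> mi; rewrite ge_max subr_ge0 kept_le /=.
case: (boolP (i \in S)) => [/kept_gain//|].
rewrite kept_upto mi /= -leNgt => /le_trans -> //.
by rewrite subr_ge0 kept_le.
Qed.

(* An element of rank below [p] is either accepted, so that its marginal is [0],
   or was rejected for the sake of a smaller set. *)
Lemma uncovered_gain (O : {set 'I_n}) p (V : 'I_n -> {set 'I_n}) :
  (forall i : 'I_n, (rk i < p)%N -> mark i) ->
  (forall i : 'I_n, (p <= rk i)%N -> V i \subset upto W p) ->
  f (O :|: upto W p) - f (upto W p) <=
  \sum_(i : 'I_n | (p <= rk i)%N) Num.max 0 (marginal f i (V i)).
Proof.
move=> mk VW; apply: le_trans (submodular_setU_le _ _ sf) _.
rewrite [leLHS]big_mkcond [leRHS]big_mkcond /=; apply: ler_sum => i _.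
case: leqP => [pi|ip].
  have : marginal f i (upto W p) <= marginal f i (V i).
    by apply: marginal_le; rewrite ?VW // inE ltnNge pi andbF.
  by case: ifP => _ m; rewrite le_max ?m ?orbT ?lexx.
case: ifP => // _; case: (boolP (i \in W)) => iW.
  by rewrite marginal_in // inE iW.
apply: (marginal_le0 sf (upto_le W (ltnW ip))).
by rewrite -below_upto; apply: marginal_not_accepted => //; exact: mk.
Qed.

End Ranked.

(** * Averaging over a single key *)

Lemma card_ord_gt (M : nat) (d : 'I_M) : #|[pred d' : 'I_M | d < d']%N| = (M - d.+1)%N.
Proof.
rewrite -sum1_card big_mkcond /=.
rewrite -(big_mkord xpredT (fun l => if (d < l)%N then 1%N else 0%N)).
rewrite (@big_cat_nat _ _ addn d.+1) //= big_nat big1 => [|l]; last first.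
  by rewrite ltnS => /andP[_]; case: ltnP.
rewrite add0n (eq_big_nat _ _ (F2 := fun=> 1%N)) => [|l /andP[-> _] //].
by rewrite sum_nat_const_nat muln1.
Qed.

Section Keys.
Variables (R : realType) (n M : nat).
Local Notation keys := {ffun 'I_n -> 'I_M}.
Implicit Types (k : keys) (i : 'I_n) (d : 'I_M).

Definition swap_key i d d' k : keys :=
  [ffun l => if l != i then k l else
     if k i == d then d' else if k i == d' then d else k i].

Lemma swap_keyK i d d' : involutive (swap_key i d d').
Proof.
move=> k; apply/ffunP => l; rewrite !ffunE eqxx /=.
case: eqP => [->|//] /=; case: (altP (k i =P d)) => [->|kd].
  by rewrite eqxx; case: eqP.
by case: (altP (k i =P d')) => [->|kd']; rewrite ?eqxx // (negbTE kd) (negbTE kd').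
Qed.

Lemma sum_swap_key (F : keys -> R) i d d' :
  (forall k, k i = d -> F (swap_key i d d' k) = F k) ->
  \sum_(k : keys | k i == d) F k = \sum_(k : keys | k i == d') F k.
Proof.
move=> FE; rewrite [RHS](reindex_inj (inv_inj (swap_keyK i d d'))) /=.
have E k : (swap_key i d d' k i == d') = (k i == d).
  rewrite ffunE eqxx /=; case: (altP (k i =P d)) => [_|kd]; first by rewrite eqxx.
  case: (altP (k i =P d')) => [kd'|/negbTE //].
  by rewrite kd' in kd; rewrite eq_sym (negbTE kd).
by apply: eq_big => [k|k /eqP kd]; rewrite ?E ?FE.
Qed.

Lemma sum_key_eq (F : keys -> R) i d :
  (forall k k', (forall l, l != i -> k l = k' l) -> F k = F k') ->
  M%:R * \sum_(k : keys | k i == d) F k = \sum_(k : keys) F k.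
Proof.
move=> FE; rewrite [RHS](partition_big (fun k : keys => k i) xpredT) //=.
rewrite [RHS](eq_bigr (fun=> \sum_(k : keys | k i == d) F k)) => [|d' _].
  by rewrite sumr_const card_ord mulr_natl.
apply/esym/sum_swap_key => k _; apply: FE => l li.
by rewrite ffunE li.
Qed.

(** The discrete form of a key being uniform above a threshold: [F] cannot tell apart keys of [i]
    that are at least [d], so swapping values shows that the fibres over [d] and over each larger
    value have equal sums. *)
Lemma sum_key_gt (F : keys -> R) i d :
  (forall k k', (forall l, l != i -> k l = k' l) ->
    (d <= k i)%N -> (d <= k' i)%N -> F k = F k') ->
  (M - d.+1)%:R * \sum_(k : keys | k i == d) F k = \sum_(k : keys | (d < k i)%N) F k.
Proof.
move=> FE;
rewrite [RHS](partition_big (fun k : keys => k i) (fun d' : 'I_M => d < d')%N) //=.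
rewrite [RHS](eq_bigr (fun=> \sum_(k : keys | k i == d) F k)) => [|d' dd'].
  by rewrite sumr_const card_ord_gt mulr_natl.
apply/esym; rewrite (@sum_swap_key _ i d d') => [|k kd].
  by apply: eq_bigl => k; case: eqP => [->|]; rewrite ?dd' ?andbF.
by apply: FE => [l li||]; rewrite ?ffunE ?li // ?eqxx ?kd ?eqxx //= ltnW.
Qed.

End Keys.

(** * The recursion over key levels *)

Section Discretized.
Variables (R : realType) (n M K : nat) (f : {set 'I_n} -> R).
Hypotheses (f0 : nonnegative f) (sf : submodular f).
Local Notation keys := {ffun 'I_n -> 'I_M}.
Implicit Types (k : keys) (i : 'I_n).

Definition key k (m : nat) : nat := oapp (fun i => k i : nat) 0%N (insub m).

(* The lexicographic order on pairs of a key and an arrival time. *)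
Definition rank k (m : nat) : nat := (key k m * n + m)%N.

Definition key_mark k : pred nat := fun m => (key k m < K)%N.

Local Notation W k := (accepted f (relpre (rank k) ltn) (key_mark k) n).
Local Notation S k := (kept f (relpre (rank k) ltn) (key_mark k) n).

Lemma keyE k i : key k i = k i.
Proof. by rewrite /key valK. Qed.

Lemma rank_inj k (i j : 'I_n) : rank k i = rank k j -> i = j.
Proof.
rewrite /rank !keyE => E; apply: val_inj => /=.
by have := congr1 (modn^~ n) E; rewrite !modnMDl !modn_small.
Qed.

Lemma rank_lt k i c : (rank k i < c * n)%N = (k i < c)%N.
Proof.
rewrite /rank keyE; have := ltn_ord i; case: (ltnP (k i) c) => kc ni; last first.
  by apply/negbTE; rewrite -leqNgt (leq_trans _ (leq_addr _ _)) // leq_mul2r kc orbT.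
apply: (@leq_trans ((k i).+1 * n)); first by rewrite mulSn addnC ltn_add2r.
by rewrite leq_mul2r kc orbT.
Qed.

(** Telescoping over the [n] ranks of level [c]: rank [c * n + i] belongs to [i] if its key is [c],
    and no step is negative. *)
Lemma kept_cell k (c : 'I_M) : (c < K)%N ->
  \sum_(i | k i == c) Num.max 0 (marginal f i (upto (rank k) (W k) (c * n + i))) <=
  f (upto (rank k) (S k) (c.+1 * n)) - f (upto (rank k) (S k) (c * n)).
Proof.
move=> cK; rewrite mulSnr.
pose g m := f (upto (rank k) (S k) (c * n + m)).
rewrite [leRHS](_ : _ = g n - g 0%N); last by rewrite /g addn0.
rewrite -(telescope_sumr g (leq0n n)) big_mkord [leLHS]big_mkcond /=.
apply: ler_sum => i _; rewrite /g addnS.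
case: eqP => [kc|_]; last by rewrite subr_ge0 (kept_le _ sf (@rank_inj k)).
have -> : (c * n + i = rank k i)%N by rewrite /rank keyE kc.
by apply: (kept_gain_max sf (@rank_inj k)); rewrite /key_mark keyE kc.
Qed.

(** The fate of an element depends only on earlier arrivals of smaller rank. With a key of at least
    [c], [i] has rank at least [c * n + i] and influences nothing below that rank. *)
Lemma upto_accepted_eq k k' i c :
  (forall l, l != i -> k l = k' l) -> (c <= k i)%N -> (c <= k' i)%N ->
  upto (rank k) (W k) (c * n + i) = upto (rank k') (W k') (c * n + i).
Proof.
move=> kk' ci ci'.
have far k0 : (c <= k0 i)%N -> (rank k0 i < c * n + i)%N = false.
  by rewrite /rank keyE ltn_add2r => c0; rewrite ltnNge leq_mul2r c0 orbT.
have rE l : l != i -> rank k l = rank k' l by move=> li; rewrite /rank !keyE kk'.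
have WE (l : 'I_n) : (rank k l < c * n + i)%N -> (l \in W k) = (l \in W k').
  have [m] := ubnP (l : nat); elim: m l => // m IH l lm rl.
  have li : l != i by apply: contraTneq rl => ->; rewrite far.
  rewrite !accepted_mem /key_mark !keyE kk' //.
  congr [&& _, _ & 0 < marginal f l _]; apply/setP => x; rewrite !inE /= -(rE l) //.
  rewrite !(accepted_restrict _ _ _ (ltnW (ltn_ord l))) !inE.
  case: (ltnP x l) => xl; last by rewrite !andbF.
  have [->|xi] := eqVneq x i.
    rewrite (ltnNge (rank k i)) (ltnNge (rank k' i)).
    rewrite !(leq_trans (ltnW rl)) ?andbF //; by rewrite leqNgt far.
  rewrite -rE //; case: (ltnP (rank k x) (rank k l)) => xr; last by rewrite !andbF.
  by rewrite IH ?(ltn_trans xr) // (leq_trans xl).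
apply/setP => l; rewrite !inE; have [->|li] := eqVneq l i; first by rewrite !far ?andbF.
rewrite -rE //; case: (ltnP (rank k l) (c * n + i)) => rl; last by rewrite !andbF.
by rewrite WE.
Qed.

Local Notation a c := (\sum_(k : keys) f (upto (rank k) (S k) (c * n))).

Lemma card_keys : #|{: keys}| = (M ^ n)%N.
Proof. by rewrite card_ffun !card_ord. Qed.

Lemma count_key_le i (c : 'I_M) :
  (M * #|[pred k : keys | (k i <= c)%N]| = c.+1 * M ^ n)%N.
Proof.
apply/eqP; rewrite -(eqr_nat R) !natrM.
have E d : M%:R * \sum_(k : keys | k i == d) (1 : R) = (M ^ n)%:R.
  by rewrite sum_key_eq // sumr_const card_keys.
rewrite -sumr_const
  (partition_big (fun k : keys => k i) (fun d : 'I_M => d <= c)%N) //=.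
rewrite mulr_sumr (eq_bigr (fun=> (M ^ n)%:R)) => [|d dc]; last first.
  rewrite -(E d); congr (_ * _); apply: eq_bigl => k.
  by rewrite inE; case: eqP => [->|]; rewrite ?dc ?andbF.
have cardE : #|[pred d : 'I_M | (d <= c)%N]| = c.+1.
  have := cardC [pred d : 'I_M | (d <= c)%N]; rewrite card_ord.
  rewrite (eq_card (A := predC _) (B := [pred d : 'I_M | (c < d)%N])) => [|d].
    rewrite card_ord_gt => cM; have := ltn_ord c.
    have {cM} : (#|[pred d : 'I_M | (d <= c)%N]| + (M - c.+1) = M)%N := cM.
    lia.
  by rewrite !inE -ltnNge.
by rewrite sumr_const mulr_natl cardE.
Qed.

(** The uncrossing bound for the function sending [X] to [f (O :|: X)]: a point lies in the prefix
    only if its key is at most [c], which holds for a fraction [c.+1 / M] of the key vectors. *)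
Lemma sum_cover_ge (O : {set 'I_n}) (c : 'I_M) :
  (M - c.+1)%:R * (M ^ n)%:R * f O <=
  M%:R * \sum_(k : keys) f (O :|: upto (rank k) (W k) (c.+1 * n)).
Proof.
pose V k := upto (rank k) (W k) (c.+1 * n).
have := @sum_submodular_ge _ R (fun X => f (O :|: X)) [seq V k | k : keys] M c.+1.
rewrite setU0 size_image card_keys big_image /=; apply.
- by move=> X; apply: f0.
- move=> X Y; rewrite setUUr (setUIr O); exact: sf.
- exact: ltn_ord.
move=> i; rewrite count_map -(count_key_le i c) leq_mul2l; apply/orP; right.
rewrite -size_filter cardE uniq_leq_size ?filter_uniq -?enumT ?enum_uniq // => k.
rewrite mem_filter mem_enum => /andP[/= ik _]; rewrite inE -ltnS -rank_lt.
by move: ik; rewrite inE => /andP[].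
Qed.

(** By symmetry, the gain offered by keys above [c] totals [M - c.+1] times that of level [c], which
    [a c.+1 - a c] bounds. The value of the accepted prefix, at most [a c.+1], raises the
    coefficient of [a c.+1] to [M - c]. *)
Lemma sum_kept_rec (O : {set 'I_n}) (c : 'I_M) : (c < K)%N ->
  (M - c.+1)%:R * (M ^ n)%:R * f O <=
  M%:R * ((M - c)%:R * a c.+1 - (M - c.+1)%:R * a c).
Proof.
move=> cK; apply: le_trans (sum_cover_ge O c) _; rewrite ler_wpM2l //.
pose mg k i := Num.max 0 (marginal f i (upto (rank k) (W k) (c * n + i))).
have cell : \sum_(k : keys) \sum_(i | k i == c) mg k i <= a c.+1 - a c.
  by rewrite -sumrB; apply: ler_sum => k _; apply: kept_cell.
have tail : (M - c.+1)%:R * (\sum_(k : keys) \sum_(i | k i == c) mg k i) =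
    \sum_(k : keys) \sum_(i | (c < k i)%N) mg k i.
  rewrite (exchange_big_dep xpredT) //= [RHS](exchange_big_dep xpredT) //=.
  rewrite mulr_sumr; apply: eq_bigr => i _; apply: sum_key_gt => k k' kk' ck ck'.
  by rewrite /mg (upto_accepted_eq kk').
have cover k : f (O :|: upto (rank k) (W k) (c.+1 * n)) <=
    \sum_(i | (c < k i)%N) mg k i + f (upto (rank k) (S k) (c.+1 * n)).
  have := @uncovered_gain _ _ f (rank k) (key_mark k) sf O (c.+1 * n)
    (fun i => upto (rank k) (W k) (c * n + i)).
  rewrite lerBlDr => /(_ _ _)/le_trans -> //.
  - move=> i; rewrite rank_lt /key_mark keyE => /leq_trans; apply; exact: cK.
  - move=> i _; apply: upto_le; rewrite mulSnr leq_add2l; exact/ltnW.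
  rewrite lerD ?(upto_accepted_le _ sf (@rank_inj k)) //.
  by rewrite (eq_bigl (fun i => (c < k i)%N)) // => i; rewrite leqNgt rank_lt -leqNgt.
apply: le_trans (ler_sum _ (fun k _ => cover k)) _.
rewrite big_split /= -tail -lerBrDr.
apply: le_trans (ler_wpM2l (ler0n _ _) cell) _.
have -> : (M - c = (M - c.+1).+1)%N by have := ltn_ord c; lia.
by rewrite -natr1; lra.
Qed.

End Discretized.

(** * Solving the recursion, and counting bad key vectors *)

Section ClosedForm.
Variables (R : realType) (n M : nat) (f : {set 'I_n} -> R).
Hypotheses (f0 : nonnegative f) (sf : submodular f).
Local Notation keys := {ffun 'I_n -> 'I_M}.
Local Notation S K k := (kept f (relpre (rank k) ltn) (key_mark K k) n).

Lemma upto_kept_all K (k : keys) : upto (rank k) (S K k) (K * n) = S K k.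
Proof.
apply/setP => i; rewrite inE rank_lt; case: (boolP (i \in S K k)) => //.
rewrite kept_mem // => [|x]; last by rewrite /= ltnn.
by rewrite /key_mark keyE => /andP[-> _].
Qed.

(** Dividing the recursion by [(M - c) * (M - c.+1)] makes it telescope: the kept sum at level [c]
    over [M - c] grows by a fixed multiple of [1 / (M - c)]. *)
Lemma sum_kept_harmonic K (O : {set 'I_n}) : (K < M)%N ->
  (M - K)%:R * (\sum_(d < K) (M - d)%:R^-1) * ((M ^ n)%:R * f O) <=
  M%:R * \sum_(k : keys) f (S K k).
Proof.
move=> KM; under [X in _ <= _ * X]eq_bigr do rewrite -upto_kept_all.
suff : forall c, (c <= K)%N ->
    (M - c)%:R * (\sum_(d < c) (M - d)%:R^-1) * ((M ^ n)%:R * f O) <=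
    M%:R * \sum_(k : keys) f (upto (rank k) (S K k) (c * n)) by apply.
elim=> [_|c IH cK].
  rewrite big_ord0 mulr0 mul0r mulr_ge0 // sumr_ge0 // => k _; exact: f0.
have cM : (c < M)%N by apply: ltn_trans KM.
have := sum_kept_rec f0 sf O (c := Ordinal cM) cK; rewrite /=.
have := IH (ltnW cK); rewrite big_ord_recr /=.
set a := (\sum_(k : keys) _); set a' := (\sum_(k : keys) _).
set h := (\sum_(d < c) _); set F := ((M ^ n)%:R * f O).
have -> : (M - c = (M - c.+1).+1)%N by lia.
set m := (M - c.+1)%N; move=> ha; rewrite -[_ * f O]mulrA -/F => hr.
have m1 : 0 < m.+1%:R :> R by rewrite ltr0n.
rewrite -(ler_pM2l m1) (_ : _ * (_ * F) = m%:R * (F + m.+1%:R * h * F)); last first.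
  by field; rewrite ?lt0r_neq0.
have : m%:R * (m.+1%:R * h * F) <= m%:R * (M%:R * a) by rewrite ler_wpM2l.
by move: hr; lra.
Qed.

(** Each [1 / m] is at least [ln (m + 1) - ln m], and these differences telescope. *)
Lemma harmonic_ge K : (K < M)%N ->
  ln (M.+1)%:R - ln (M - K).+1%:R <= \sum_(d < K) (M - d)%:R^-1 :> R.
Proof.
elim: K => [|K IH KM]; first by rewrite big_ord0 subn0 subrr.
rewrite big_ord_recr /=; have := IH (ltnW KM).
have -> : (M - K = (M - K.+1).+1)%N by lia.
set m := (M - K.+1)%N => h.
suff : ln m.+2%:R - ln m.+1%:R <= m.+1%:R^-1 :> R.
  by move=> /(lerD h); apply: le_trans; rewrite addrA subrK.
have m1 : 0 < m.+1%:R :> R by rewrite ltr0n.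
rewrite -ln_div ?posrE ?ltr0n // -[m.+2%:R]natr1 mulrDl divff ?lt0r_neq0 // mul1r.
by apply: le_ln1Dx; rewrite (lt_trans (ltrN10 _)) ?invr_gt0.
Qed.

(** Here [K] is the integer part of [M p]. The harmonic sum falls short of [- ln (1 - p)] by at most
    [2 / (M (1 - p))], whence the constant 2. *)
Lemma sum_kept_ge (p : R) K (O : {set 'I_n}) : p < 1 -> (0 < M)%N ->
  K%:R <= M%:R * p < K.+1%:R ->
  (M%:R * ((1 - p) * - ln (1 - p)) - 2) * ((M ^ n)%:R * f O) <=
  M%:R * \sum_(k : keys) f (S K k).
Proof.
move=> p1 Mpos /andP[Kp pK].
have q0 : 0 < 1 - p by lra.
have M0 : 0 < M%:R :> R by rewrite ltr0n.
have p0 : 0 <= p by rewrite -(pmulr_rge0 p M0) (le_trans _ Kp).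
have KM : (K < M)%N.
  by rewrite -(ltr_nat R) (le_lt_trans Kp) // -subr_gt0 -{1}[M%:R]mulr1 -mulrBr mulr_gt0.
apply: le_trans (sum_kept_harmonic O KM).
rewrite ler_wpM2r ?mulr_ge0 //.
have := harmonic_ge KM; set h := (\sum_(d < K) _) => hh.
have h0 : 0 <= h by rewrite sumr_ge0 // => d _; rewrite invr_ge0.
have MK : M%:R * (1 - p) <= (M - K)%:R by rewrite natrB ?(ltnW KM) //; lra.
apply: le_trans (ler_wpM2r h0 MK).
suff hq : - ln (1 - p) - 2 / (M%:R * (1 - p)) <= h.
  have Mq : 0 < M%:R * (1 - p) by rewrite mulr_gt0.
  apply: le_trans (ler_wpM2l (ltW Mq) hq).
  by rewrite mulrBr mulrA [leRHS]addrC mulrCA divff ?lt0r_neq0 // mulr1 addrC.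
apply: le_trans hh.
have MS : 0 < M.+1%:R :> R by rewrite ltr0n.
have qMS : 0 < (1 - p) * M.+1%:R by rewrite mulr_gt0.
(* Chosen so that [(1 - p) * M.+1 * (1 + y)] equals [M (1 - p) + 2], which exceeds [(M - K).+1]. *)
pose y := (2 - (1 - p)) / ((1 - p) * M.+1%:R).
have y0 : 0 <= y by rewrite divr_ge0 ?(ltW qMS) //; lra.
have le_ln : ln ((M - K).+1)%:R <= ln (1 - p) + ln M.+1%:R + ln (1 + y) :> R.
  have y1 : 0 < 1 + y by lra.
  rewrite -lnM ?posrE // -lnM ?posrE // ler_ln ?posrE ?ltr0n ?(mulr_gt0 qMS) //.
  rewrite mulrDr mulr1 /y mulrCA divff ?lt0r_neq0 // mulr1 -!natr1.
  by rewrite natrB ?(ltnW KM) //; move: pK; rewrite -natr1; lra.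
have ly : ln (1 + y) <= y by apply: le_ln1Dx; lra.
have : y <= 2 / (M%:R * (1 - p)).
  rewrite /y ler_pM ?invr_ge0 ?(ltW qMS) //; try lra.
  rewrite lef_pV2 ?posrE ?mulr_gt0 // mulrC ler_wpM2l ?(ltW q0) //.
  by rewrite ler_nat.
lra.
Qed.

(** Rounding may change comparisons on these key vectors. A union bound over [n] events and [n * n]
    pairs, each of frequency at most [1 / M]. *)
Lemma card_bad_keys_le K :
  (M * #|[pred k : keys | [exists i, k i == K :> nat] ||
           [exists i, exists j, (i != j) && (k i == k j)]]| <= (n + n * n) * M ^ n)%N.
Proof.
rewrite -(ler_nat R) !natrM -sumr_const.
pose F1 (i : 'I_n) (k : keys) : R := (k i == K :> nat)%:R.
pose F2 (i j : 'I_n) (k : keys) : R := ((i != j) && (k i == k j))%:R.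
have le1 : \sum_(k : keys | [exists i, k i == K :> nat] ||
     [exists i, exists j, (i != j) && (k i == k j)]) (1 : R) <=
     \sum_(k : keys) (\sum_i F1 i k + \sum_i \sum_j F2 i j k).
  rewrite big_mkcond /=; apply: ler_sum => k _.
  have F10 : 0 <= \sum_i F1 i k by rewrite sumr_ge0 // => i _; exact: ler0n.
  have F20 i : 0 <= \sum_j F2 i j k by rewrite sumr_ge0 // => j _; exact: ler0n.
  have F200 : 0 <= \sum_i \sum_j F2 i j k by rewrite sumr_ge0.
  case: ifP => [/orP[/existsP[i ki]|/existsP[i /existsP[j kij]]]|_]; last by rewrite addr_ge0.
    rewrite -[1]addr0 lerD // (bigD1 i) //= {1}/F1 ki lerDl.
    by rewrite sumr_ge0 // => j _; exact: ler0n.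
  rewrite -[1]add0r lerD // (bigD1 i) //= -[1]addr0 lerD ?sumr_ge0 //.
  by rewrite (bigD1 j) //= {1}/F2 kij lerDl sumr_ge0 // => l _; exact: ler0n.
have sum1 : \sum_(k : keys) (1 : R) = (M ^ n)%:R by rewrite sumr_const card_keys.
have S1 i : M%:R * \sum_(k : keys) F1 i k <= (M ^ n)%:R.
  have [KM|MK] := ltnP K M; last first.
    rewrite big1 ?mulr0 // => k _; rewrite /F1; case: eqP => // E.
    by have := ltn_ord (k i); rewrite E ltnNge MK.
  rewrite -sum1 -(@sum_key_eq _ _ _ (fun=> 1) i (Ordinal KM)) //.
  rewrite [X in _ <= _ * X]big_mkcond.
  apply: ler_wpM2l => //; apply: ler_sum => k _; rewrite /F1 -val_eqE /=.
  by case: eqP.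
have S2 i j : M%:R * \sum_(k : keys) F2 i j k <= (M ^ n)%:R.
  have [->|ij] := eqVneq i j; first by rewrite big1 ?mulr0 // => k _; rewrite /F2 eqxx.
  rewrite -sum1 [leRHS](partition_big (fun k : keys => k j) xpredT) //=.
  rewrite (partition_big (fun k : keys => k j) xpredT) //= mulr_sumr.
  apply: ler_sum => d _; rewrite [leRHS]big_mkcond [X in _ * X]big_mkcond /=.
  rewrite -(@sum_key_eq _ _ _ (fun k : keys => if k j == d then 1 else 0) i d) =>
    [|k k' kk']; last by rewrite kk' // eq_sym.
  rewrite [X in _ <= _ * X]big_mkcond ler_wpM2l //; apply: ler_sum => k _.
  rewrite /F2 ij /=; case: (k j =P d) => [->|_]; last by case: ifP.
  by case: (k i == d).
apply: le_trans (ler_wpM2l (ler0n _ M) le1) _.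
rewrite big_split mulrDr natrD mulrDl /=; apply: lerD.
  rewrite exchange_big mulr_sumr /= [leRHS]mulr_natl
    -[X in _ <= _ *+ X](card_ord n) -sumr_const.
  exact: ler_sum.
rewrite exchange_big mulr_sumr /= natrM -mulrA [leRHS]mulr_natl
  -[X in _ <= _ *+ X](card_ord n) -sumr_const.
apply: ler_sum => i _; rewrite exchange_big mulr_sumr /= [leRHS]mulr_natl
    -[X in _ <= _ *+ X](card_ord n) -sumr_const.
exact: ler_sum.
Qed.

End ClosedForm.

(** * Running the process on the revealed elements *)

Section EmbeddedInstances.
Variables (R : realType) (i n : nat).
Hypothesis leq_in : (i <= n)%N.
Implicit Types (X : {set 'I_i}) (k : 'I_i).

Lemma mem_embed X k : (widen_ord leq_in k \in embed n X) = (k \in X).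
Proof.
rewrite inE; apply/existsP/idP => [[l /andP[lX /eqP lk]]|kX].
  by rewrite (_ : k = l) //; apply: val_inj.
by exists k; rewrite kX /=.
Qed.

Lemma embed_lt X (j : 'I_n) : j \in embed n X -> (j < i)%N.
Proof. by rewrite inE => /existsP[l /andP[_ /eqP <-]]. Qed.

Lemma embedP X (Y : {set 'I_n}) : (forall j, j \in Y -> (j < i)%N) ->
  (forall k, (widen_ord leq_in k \in Y) = (k \in X)) -> embed n X = Y.
Proof.
move=> Yi YX; apply/setP => j; case: (ltnP j i) => ji.
  by rewrite (_ : j = widen_ord leq_in (Ordinal ji)) ?mem_embed ?YX //; apply: val_inj.
by apply/idP/idP => [/embed_lt|/Yi]; rewrite ltnNge ji.
Qed.

Lemma marginal_revealed (f : {set 'I_n} -> R) X k :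
  marginal (revealed f i) k X = marginal f (widen_ord leq_in k) (embed n X).
Proof.
rewrite /marginal /revealed; congr (f _ - _); apply: embedP => [j|l].
  by rewrite in_setU1 => /orP[/eqP->|/embed_lt //]; exact: (ltn_ord k).
by rewrite !in_setU1 mem_embed.
Qed.

Lemma embed_below lt X k : embed n (below lt X k) = below lt (embed n X) k.
Proof.
apply: embedP => [j|l]; first by rewrite inE => /andP[/embed_lt].
by rewrite [LHS]inE mem_embed inE.
Qed.

Lemma embed_accepted (f : {set 'I_n} -> R) lt mark m : (m <= i)%N ->
  embed n (accepted (revealed f i) lt mark m) = accepted f lt mark m.
Proof.
elim: m => [|m IH] mi; apply: embedP => [j|k].
- by rewrite inE.
- by rewrite !inE.
- by rewrite accepted_mem => /andP[/leq_trans -> //].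
rewrite /= !in_setU -mem_embed IH ?(ltnW mi) // !inE marginal_revealed embed_below.
by rewrite IH ?(ltnW mi).
Qed.

(** Up to time [i] the process evaluates [f] only on sets of the first [i] elements, so the revealed
    values determine it. *)
Lemma embed_kept (f : {set 'I_n} -> R) lt mark :
  embed n (kept (revealed f i) lt mark i) = kept f lt mark i.
Proof.
apply: embedP => [j|k].
  by rewrite inE => /andP[]; rewrite accepted_mem => /andP[->].
by rewrite [LHS]inE [RHS]inE -embed_accepted // mem_embed marginal_revealed embed_below.
Qed.

End EmbeddedInstances.

(** * The online algorithm with real keys *)

Section ThresholdGreedy.
Variables (R : realType) (p : R).

Definition key_lt (tape : nat -> R) : rel nat := fun j l => tape j < tape l.

Definition threshold_greedy : online_algorithm R := fun i v tape =>
  kept v (key_lt tape) (fun j => tape j < p) i.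

(** By [kept_next] the wanted set consists of candidates, so the intersection in [solution] leaves
    it intact. *)
Lemma solution_threshold_greedy n (f : {set 'I_n} -> R) tape i :
  submodular f -> (i <= n)%N ->
  solution threshold_greedy f tape i = kept f (key_lt tape) (fun j => tape j < p) i.
Proof.
move=> sf; elim: i => [|i IH] i_n; first by apply/setP => j; rewrite !inE.
rewrite /= IH ?(ltnW i_n) // /threshold_greedy embed_kept //; apply/setIidPr.
by apply: kept_next => // x; rewrite /key_lt ltxx.
Qed.

End ThresholdGreedy.

Lemma eq_solution (R : realType) (A A' : online_algorithm R) n
    (f : {set 'I_n} -> R) tape i :
  (forall m v, A m v tape = A' m v tape) ->
  solution A f tape i = solution A' f tape i.
Proof. by move=> AA; elim: i => //= i ->; rewrite AA. Qed.

(** * Measurability and rounding of real keys *)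

Section Measurability.
Context d (T : measurableType d).

(** [A] is a union of atoms of the finite algebra generated by the events [E i]. *)
Lemma measurable_determined (J : finType) (E : J -> T -> bool)
    (A : classical_sets.set T) :
  (forall i, measurable [set x | E i x]%classic) ->
  (forall x y, (forall i, E i x = E i y) -> A x -> A y) -> measurable A.
Proof.
move=> mE AE.
pose C (b : {ffun J -> bool}) : classical_sets.set T :=
  (\bigcap_(i in [set: J]) [set x | E i x = b i])%classic.
have -> : A = (\bigcup_(b in [set b | exists2 x, A x & C b x]) C b)%classic.
  apply/classical_sets.seteqP; split => [x Ax|y [b [x Ax Cx] Cy]].
    by exists [ffun i => E i x]; [exists x|] => // i _ /=; rewrite ffunE.
  by apply: (AE x) Ax => i; rewrite (Cx i I) (Cy i I).
apply: fin_bigcup_measurable; first exact: (@finite_finset {ffun J -> bool}).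
move=> b _; apply: fin_bigcap_measurable => //.
move=> i _; case: (b i); first exact: mE.
rewrite (_ : [set x | _]%classic = (~` [set x | E i x])%classic).
  by apply: measurableC; exact: mE.
by apply/classical_sets.seteqP; split => x /= /negP; rewrite ?negbK; case: (E i x).
Qed.

End Measurability.
Definition cell (R : realType) (M d : nat) : classical_sets.set R :=
  [set` `[d%:R / M%:R, d.+1%:R / M%:R[%R]%classic.
Arguments cell : clear implicits.

Lemma uniform_cell (R : realType) (M d : nat) : (d < M)%N ->
  uniform_prob (@ltr01 R) (cell R M d) = (M%:R^-1)%:E.
Proof.
move=> dM; have M0 : 0 < M%:R :> R by rewrite ltr0n (leq_ltn_trans _ dM).
rewrite /uniform_prob integral_uniform_pdf (_ : classical_sets.setI _ _ = cell R M d).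
  rewrite (@eq_integral _ _ _ _ _ (fun=> 1%:E)) => [|x].
    rewrite integral_cst /=; last exact: measurable_itv.
    rewrite mul1e lebesgue_measure_itv /= lte_fin.
    rewrite ltr_pM2r ?invr_gt0 // ltr_nat leqnn -EFinD -mulrBl -natr1.
    by rewrite addrC addKr mul1r.
  move=> /classical_sets.set_mem; rewrite /cell /= in_itv /= => /andP[dx xd].
  rewrite /uniform_pdf.
  rewrite subr0 invr1 (le_trans _ dx) ?divr_ge0 // (le_trans (ltW xd)) //.
  by rewrite ler_pdivrMr // mul1r ler_nat.
apply/classical_sets.setIidPl => x; rewrite /cell /= !in_itv /= => /andP[dx xd].
rewrite (le_trans _ dx) ?divr_ge0 // (le_trans (ltW xd)) //.
by rewrite ler_pdivrMr // mul1r ler_nat.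
Qed.

(** Distinct rounded keys are ordered like the real ones. As [M p] rounds down to [K], a rounded key
    other than [K] compares with [K] as the real key does with [p]. *)
Lemma kept_cell_key (R : realType) (n M K : nat) (f : {set 'I_n} -> R) (p : R)
    (tape : nat -> R) (k : {ffun 'I_n -> 'I_M}) :
  K%:R <= M%:R * p < K.+1%:R ->
  (forall i : 'I_n, cell R M (k i) (tape i)) ->
  ~~ ([exists i, k i == K :> nat] || [exists i, exists j, (i != j) && (k i == k j)]) ->
  kept f (key_lt tape) (fun j => tape j < p) n =
  kept f (relpre (rank k) ltn) (key_mark K k) n.
Proof.
move=> /andP[Kp pK] tk; rewrite negb_or !negb_exists => /andP[/forallP kK /forallP kk].
have bnd (i : 'I_n) : (k i)%:R <= M%:R * tape i < (k i).+1%:R.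
  have M0 : 0 < M%:R :> R by rewrite ltr0n (leq_ltn_trans _ (ltn_ord (k i))).
  have := tk i; rewrite /cell /= in_itv /= ler_pdivrMr // ltr_pdivlMr //.
  by rewrite mulrC.
have M0 (i : 'I_n) : 0 < M%:R :> R.
  by rewrite ltr0n (leq_ltn_trans _ (ltn_ord (k i))).
have le_key (i : 'I_n) m : (k i < m)%N -> M%:R * tape i < m%:R.
  move=> km; have /andP[_] := bnd i => /lt_le_trans; apply.
  by rewrite ler_nat.
apply: eq_kept => [j l|j].
  rewrite /key_lt /= /rank !keyE -(ltr_pM2l (M0 j)).
  have [->|jl] := eqVneq j l; first by rewrite ltxx ltnn.
  have := kk j; rewrite negb_exists => /forallP/(_ l); rewrite jl /= -val_eqE /=.
  have lt_rank (i i' : 'I_n) : (k i < k i')%N -> (k i * n + i < k i' * n + i')%N.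
    move=> kl; apply: (@leq_trans ((k i).+1 * n)).
      by rewrite mulSn addnC ltn_add2r.
    by apply: leq_trans (leq_addr _ _); rewrite leq_mul2r kl orbT.
  case: (ltngtP (k j) (k l)) => // kjl _.
    rewrite lt_rank //; have /andP[h _] := bnd l.
    exact: lt_le_trans (le_key _ _ kjl) h.
  rewrite [RHS]ltnNge (ltnW (lt_rank _ _ kjl)) /=; apply/negbTE; rewrite -leNgt.
  have /andP[h _] := bnd j.
  exact/ltW/(lt_le_trans (le_key _ _ kjl) h).
rewrite /key_mark keyE -(ltr_pM2l (M0 j)).
have := kK j; case: (ltngtP (k j) K) => // kj _.
  exact: lt_le_trans (le_key _ _ kj) Kp.
apply/negbTE; rewrite -leNgt; have /andP[h _] := bnd j.
by apply: le_trans h; apply: le_trans (ltW pK) _; rewrite ler_nat.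
Qed.

(** Each bad key vector loses at most [C], and these form a fraction of at most
    [(n + n * n) / M]. *)
Lemma sum_good_ge (R : realType) (n M K : nat) (f : {set 'I_n} -> R) (p C : R)
    (O : {set 'I_n}) (G : {ffun 'I_n -> 'I_M} -> R) :
  nonnegative f -> submodular f -> (forall X, f X <= C) ->
  p < 1 -> (0 < M)%N -> K%:R <= M%:R * p < K.+1%:R ->
  (forall k : {ffun 'I_n -> 'I_M},
    ~~ ([exists i, k i == K :> nat] || [exists i, exists j, (i != j) && (k i == k j)]) ->
    G k = f (kept f (relpre (rank k) ltn) (key_mark K k) n)) ->
  (forall k, 0 <= G k) ->
  (1 - p) * - ln (1 - p) * f O - (2 * f O + C * (n + n * n)%:R) / M%:R <=
  (M ^ n)%:R^-1 * \sum_k G k.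
Proof.
move=> f0 sf fC p1 M0 pK GE G0.
have Mp : 0 < M%:R :> R by rewrite ltr0n.
have Np : 0 < (M ^ n)%:R :> R by rewrite ltr0n expn_gt0 M0.
have := sum_kept_ge f0 sf O p1 M0 pK.
have := card_bad_keys_le R n M K; rewrite -(ler_nat R) !natrM.
set bad := #|_|; set N := (M ^ n)%:R; set s := \sum_(k : _) f _ => badN sN.
have C0 : 0 <= C by apply: le_trans (f0 O) (fC O).
have sG : s <= \sum_k G k + bad%:R * C.
  rewrite mulr_natl -sumr_const [X in _ + X]big_mkcond -big_split /=.
  apply: ler_sum => k _; rewrite inE.
  by case: (boolP (_ || _)) => [_|/GE ->]; rewrite ?addr0 // ler_wpDl.
have {}sG : M%:R * s <= M%:R * \sum_k G k + (n + n * n)%:R * N * C.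
  apply: le_trans (ler_wpM2l (ler0n _ M) sG) _.
  by rewrite mulrDr lerD2l mulrA ler_wpM2r // natrD natrM.
rewrite -(ler_pM2l Mp) -(ler_pM2l Np).
rewrite [leRHS](_ : _ = M%:R * \sum_k G k); last first.
  by field; rewrite lt0r_neq0.
rewrite [leLHS](_ : _ = (M%:R * ((1 - p) * - ln (1 - p)) - 2) * (N * f O) -
   (n + n * n)%:R * N * C); last by field; rewrite lt0r_neq0.
lra.
Qed.

(** * From rounded keys to the expectation *)

Section Expectation.
Variables (R : realType) (d : measure_display) (Omega : measurableType d).
Variables (P : probability Omega R) (U : nat -> {RV P >-> R}).
Hypothesis iidU : iid_uniform U.
Variables (n : nat) (f : {set 'I_n} -> R) (p : R).
Hypotheses (f0 : nonnegative f) (sf : submodular f) (p1 : 0 <= p < 1).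

Let Sn (w : Omega) := kept f (key_lt (fun j => U j w)) (fun j => U j w < p) n.

Lemma measurable_kept (Q : {set 'I_n} -> Prop) :
  measurable [set w | Q (Sn w)]%classic.
Proof.
pose E (e : 'I_n * 'I_n + 'I_n) (w : Omega) := match e with
  | inl (j, l) => U j w < U l w | inr j => U j w < p end.
have mlt (g h : Omega -> R) :
    measurable_fun classical_sets.setT g -> measurable_fun classical_sets.setT h ->
    measurable [set w | g w < h w]%classic.
  move=> mg mh; rewrite -[X in measurable X]classical_sets.setTI.
  by apply: (measurable_fun_ltr mg mh measurableT (Y := [set true]%classic)).
apply: (@measurable_determined _ _ _ E) => [[[j l]|j]|w w' EE] /=.
- exact: mlt.
- exact: (mlt (U j) (cst p)).
suff -> : Sn w = Sn w' by [].
apply: eq_kept => [j l|j]; first exact: (EE (inl (j, l))).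
exact: (EE (inr j)).
Qed.

Let cellw M (k : {ffun 'I_n -> 'I_M}) : classical_sets.set Omega :=
  (\bigcap_(m < n) (U m @^-1` cell R M (key k m)))%classic.

Lemma measurable_cellw M (k : {ffun 'I_n -> 'I_M}) : measurable (cellw k).
Proof.
apply: bigcap_measurableType => m _; by apply: measurable_funPTI; exact: measurable_itv.
Qed.

Lemma prob_cellw M (k : {ffun 'I_n -> 'I_M}) : P (cellw k) = ((M ^ n)%:R^-1)%:E.
Proof.
have [U1 U2] := iidU; rewrite U2 => [|m]; last exact: measurable_itv.
rewrite (eq_bigr (fun=> (M%:R^-1)%:E)) => [|i _].
  by rewrite prodEFin big_const_ord iter_mulr_1 natrX exprVn.
by rewrite U1 ?keyE ?uniform_cell //; exact: measurable_itv.
Qed.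

Lemma cellw_inj M (k k' : {ffun 'I_n -> 'I_M}) w : cellw k w -> cellw k' w -> k = k'.
Proof.
move=> kw kw'; apply/ffunP => i; apply: val_inj => /=.
have M0 : 0 < M%:R :> R by rewrite ltr0n (leq_ltn_trans _ (ltn_ord (k i))).
have := kw' i (ltn_ord i); have := kw i (ltn_ord i); rewrite /cell /= !keyE !in_itv /=.
rewrite !ler_pdivrMr // !ltr_pdivlMr // => /andP[k1 k2] /andP[k1' k2'].
have : (k i)%:R < (k' i).+1%:R :> R by apply: le_lt_trans k2'.
have : (k' i)%:R < (k i).+1%:R :> R by apply: le_lt_trans k2.
by rewrite !ltr_nat !ltnS => h h'; apply/eqP; rewrite eqn_leq h h'.
Qed.

(** The step function equal to [G k] on the cell of [k] lies below [f (Sn w)]: the cells are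
    disjoint, and outside them it is 0 while [f] is nonnegative. *)
Lemma expectation_cell_ge M (G : {ffun 'I_n -> 'I_M} -> R) :
  (forall k, 0 <= G k) -> (forall k w, cellw k w -> G k <= f (Sn w)) ->
  (((M ^ n)%:R^-1 * \sum_k G k)%:E <= 'E_P[fun w => f (Sn w)])%E.
Proof.
move=> G0 GS; rewrite expectation.unlock mulr_sumr -sumEFin.
rewrite (eq_bigr (fun k => \int[P]_w (G k * \1_(cellw k) w)%:E)%E) => [|k _]; last first.
  rewrite (@integralZl_indic _ _ _ _ _ measurableT (fun=> cellw k)) //.
  - rewrite integral_indic ?classical_sets.setIT //; last exact: measurable_cellw.
    rewrite EFinM muleC; congr (_ * _)%E; exact/esym/prob_cellw.
  - by rewrite ltNge G0.
  - exact: measurable_cellw.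
have mG k : measurable_fun classical_sets.setT (fun w => (G k * \1_(cellw k) w)%:E).
  apply/measurable_EFinP/measurable_funM => //.
  by apply: measurable_indic; exact: measurable_cellw.
have G1 k w : (0 <= (G k * \1_(cellw k) w)%:E)%E by rewrite lee_fin mulr_ge0.
rewrite -ge0_integral_sum //; apply: ge0_le_integral => //.
- by move=> w _; apply: sume_ge0 => k _.
- by apply: emeasurable_sum.
- move=> _ Y mY; rewrite classical_sets.setTI.
  exact: (measurable_kept (fun X => Y (f X)%:E)).
move=> w _; rewrite sumEFin lee_fin.
have [[k kw]|nk] := pselect (exists k : {ffun 'I_n -> 'I_M}, cellw k w).
  rewrite (bigD1 k) //= big1 => [|k' k'k].
    by rewrite addr0 indicE classical_sets.mem_set // mulr1 GS.
  rewrite indicE classical_sets.memNset ?mulr0 // => k'w.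
  by rewrite (cellw_inj k'w kw) eqxx in k'k.
rewrite big1 // => k _; rewrite indicE classical_sets.memNset ?mulr0 // => kw.
by apply: nk; exists k.
Qed.

(** The rounded bound holds for every positive [M] with error [D / M], while the right side does not
    depend on [M]. *)
Lemma expectation_kept_ge (O : {set 'I_n}) :
  (((1 - p) * - ln (1 - p) * f O)%:E <= 'E_P[fun w => f (Sn w)])%E.
Proof.
have /andP[p0 lt_p1] := p1.
pose C := \sum_X f X.
have fC X : f X <= C by rewrite /C (bigD1 X) //= lerDl sumr_ge0 // => Y _; exact: f0.
pose D := 2 * f O + C * (n + n * n)%:R.
have D0 : 0 <= D.
  by rewrite addr_ge0 ?mulr_ge0 ?f0 //; apply: le_trans (f0 O) (fC O).
suff step M : (0 < M)%N ->
    (((1 - p) * - ln (1 - p) * f O - D / M%:R)%:E <= 'E_P[fun w => f (Sn w)])%E.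
  apply/lee_addgt0Pr => e e0; rewrite -leeBlDr // -EFinB.
  have De : 0 <= D / e by rewrite divr_ge0 // ltW.
  have DM := archi_boundP De; set M := Num.bound _ in DM.
  have M0 : 0 < M%:R :> R by apply: le_lt_trans DM.
  apply: le_trans (step M _); last by rewrite -(ltr_nat R).
  rewrite lee_fin lerD2l lerN2 ler_pdivrMr // mulrC -ler_pdivrMr //.
  exact: ltW.
move=> M0; have Mp : 0 <= M%:R * p by rewrite mulr_ge0.
have pK := truncn_itv Mp; set K := Num.truncn _ in pK.
pose bad (k : {ffun 'I_n -> 'I_M}) := [exists i, k i == K :> nat] ||
  [exists i, exists j, (i != j) && (k i == k j)].
pose G k := if bad k then 0 else f (kept f (relpre (rank k) ltn) (key_mark K k) n).
have G0 k : 0 <= G k by rewrite /G; case: ifP.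
apply: (@le_trans _ _ ((M ^ n)%:R^-1 * \sum_k G k)%:E).
  rewrite lee_fin; apply: (sum_good_ge O f0 sf fC lt_p1 M0 pK) => // k.
  by rewrite -/(bad k) /G => /negbTE ->.
apply: expectation_cell_ge => // k w kw; rewrite /G.
case: (boolP (bad k)) => [_|nbad]; first exact: f0.
rewrite -(kept_cell_key (tape := fun j => U j w) f pK) // => i.
by have := kw i (ltn_ord i); rewrite /= keyE.
Qed.

End Expectation.

(** Serves both claims: [A] may be the ideal algorithm or the one computed by a program. *)
Lemma competitive_threshold_greedy (R : realType) (p alpha : R)
    (A : online_algorithm R) :
  0 <= p < 1 -> alpha <= (1 - p) * - ln (1 - p) ->
  (forall i v tape, A i v tape = threshold_greedy p v tape) ->
  competitive alpha A.
Proof.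
move=> p1 ap AE d Omega P U iidU n f f0 sf Sn.
have -> : Sn = fun w => kept f (key_lt (fun j => U j w)) (fun j => U j w < p) n.
  apply/funext => w; rewrite /Sn (@eq_solution _ _ (threshold_greedy p)) //.
  exact: solution_threshold_greedy.
split=> [T|]; first exact: (measurable_kept U f p (fun X => X = T)).
have [S maxE] : exists S, \big[Num.max/f set0]_(T : {set 'I_n}) f T = f S.
  elim/big_ind: _ => [|x y [X ->] [Y ->]|T _]; [by exists set0| |by exists T].
  by case: leP => _; [exists Y|exists X].
rewrite maxE; apply: le_trans (expectation_kept_ge iidU f0 sf p1 S).
by rewrite lee_fin ler_wpM2r.
Qed.

(* Array 0 holds the solution, array 1 the accepted elements, array 2 the
   queried set, array 3 the number of earlier arrivals; arrays 4 and 5 are loop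
   counters. Real array 0 holds the keys, real arrays 1 and 2 hold the values
   of a set without and with the element under test. *)
Definition marginal_test : prog :=
  Seq (For 5 (NAdd (NCell 3 (NConst 0)) (NConst 1))
        (If (BAnd (BNle (NConst 1) (NCell 1 (NCell 5 (NConst 0))))
                  (BNot (BRle (RCell 0 (NCell 4 (NConst 0)))
                              (RCell 0 (NCell 5 (NConst 0))))))
            (NSet 2 (NCell 5 (NConst 0)) (NConst 1))
            (NSet 2 (NCell 5 (NConst 0)) (NConst 0))))
 (Seq (Query 1 (NConst 0) 2)
 (Seq (NSet 2 (NCell 4 (NConst 0)) (NConst 1))
      (Query 2 (NConst 0) 2))).

Definition gain : bexpr := BNot (BRle (RCell 2 (NConst 0)) (RCell 1 (NConst 0))).

(** Each arrival decides on the newcomer and then rebuilds the solution by testing every arrived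
    element. The threshold is the quotient of [a] and [b] because the machine has only natural
    constants. *)
Definition greedy_prog (a b : nat) : prog :=
  Seq (Draw 0 (NCell 3 (NConst 0)))
 (Seq (NSet 4 (NConst 0) (NCell 3 (NConst 0)))
 (Seq marginal_test
 (Seq (If (BAnd gain (BNot (BRle (RDiv (RNat (NConst a)) (RNat (NConst b)))
                                  (RCell 0 (NCell 3 (NConst 0))))))
          (NSet 1 (NCell 3 (NConst 0)) (NConst 1))
          Skip)
 (Seq (For 4 (NAdd (NCell 3 (NConst 0)) (NConst 1))
        (Seq marginal_test
             (If (BAnd gain (BNle (NConst 1) (NCell 1 (NCell 4 (NConst 0)))))
                 (NSet 0 (NCell 4 (NConst 0)) (NConst 1))
                 (NSet 0 (NCell 4 (NConst 0)) (NConst 0)))))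
      (NSet 3 (NConst 0) (NAdd (NCell 3 (NConst 0)) (NConst 1))))))).

#[local] Arguments accepted : simpl never.

(** * Correctness and cost of the program *)

Section Execution.
Variables (R : realType) (n : nat) (f : {set 'I_n} -> R) (tape : nat -> R).
Implicit Type st : state R.

Local Notation oracle c := (fun b => f [set j : 'I_n | (j < c.+1)%N && b j]).

Lemma exec_for oracle (I : nat -> state R -> Prop) a e p st :
  I 0%N (tick (ncost e).+1 st) ->
  (forall k s, (k < neval st e)%N -> I k s ->
    I k.+1 (exec oracle tape p (tick 1 (nset a 0 k s)))) ->
  I (neval st e) (exec oracle tape (For a e p) st).
Proof.
move=> I0 IS; rewrite /=; set N := neval st e.
suff: forall m, (m <= N)%N ->
    I m (foldl (fun s k => exec oracle tape p (tick 1 (nset a 0 k s)))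
    (tick (ncost e).+1 st) (iota 0 m)) by apply.
elim=> [//|m IH mN]; rewrite -addn1 iotaD foldl_cat /= addn1.
by apply: IS => //; apply: IH; apply: ltnW.
Qed.

Lemma exec_seq oracle p1 p2 st :
  exec oracle tape (Seq p1 p2) st = exec oracle tape p2 (exec oracle tape p1 st).
Proof. by []. Qed.

Lemma exec_if oracle b p1 p2 st :
  exec oracle tape (If b p1 p2) st =
  exec oracle tape (if beval st b then p1 else p2) (tick (bcost b).+1 st).
Proof. by rewrite /=; case: beval. Qed.

(** The postcondition of [marginal_test]: among the natural arrays only the scratch arrays 2 and 5
    may change. *)
Definition tested (W : pred nat) c v st st' :=
  [/\ forall x j, x != 2 -> x != 5 -> ncell st' x j = ncell st x j,
      rcell st' 0 =1 rcell st 0 /\ drawn st' = drawn st,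
      rcell st' 1 0 = f [set j : 'I_n | (j < c.+1)%N && W j],
      rcell st' 2 0 = f [set j : 'I_n | (j < c.+1)%N && ((j == v :> nat) || W j)] &
      (steps st' <= steps st + 40 * c.+2)%N].

Lemma exec_marginal_test c v st : ncell st 3 0 = c -> ncell st 4 0 = v ->
  (v <= c)%N ->
  tested (fun j => (ncell st 1 j != 0%N) && (rcell st 0 j < rcell st 0 v)) c v st
    (exec (oracle c) tape marginal_test st).
Proof.
move=> cE vE vc; set W := (fun j => _).
rewrite /marginal_test exec_seq; set loop := For 5 _ _.
pose I k s := [/\ forall x j, x != 2 -> x != 5 -> ncell s x j = ncell st x j,
  rcell s = rcell st /\ drawn s = drawn st,
  forall j, (j < k)%N -> (ncell s 2 j != 0%N) = W j &
  (steps s <= steps st + 10 + 30 * k)%N].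
have [] : I c.+1 (exec (oracle c) tape loop st).
  have -> : c.+1 = neval st (NAdd (NCell 3 (NConst 0)) (NConst 1)) by rewrite /= cE addn1.
  apply: exec_for => [|k s _ [nE [rE dE] wE sE]].
    by split=> //=; lia.
  rewrite exec_if; set s1 := tick 1 (nset 5 0 k s).
  have -> : beval s1 (BAnd (BNle (NConst 1) (NCell 1 (NCell 5 (NConst 0))))
      (BNot (BRle (RCell 0 (NCell 4 (NConst 0))) (RCell 0 (NCell 5 (NConst 0)))))) = W k.
    by rewrite /= /upd /= !nE // vE rE -ltNge lt0n.
  have -> : (if W k then NSet 2 (NCell 5 (NConst 0)) (NConst 1)
      else NSet 2 (NCell 5 (NConst 0)) (NConst 0)) =
      NSet 2 (NCell 5 (NConst 0)) (NConst (W k)) by case: (W k).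
  split=> /=; rewrite /upd /=.
  - by move=> x j x2 x5; rewrite (negbTE x2) (negbTE x5) /= nE.
  - by [].
  - move=> j; rewrite ltnS leq_eqVlt; case: eqP => [-> _|_ /= jk]; first by case: (W k).
    exact: wE.
  - by lia.
move: (exec _ _ loop st) => s1 nE [rE dE] wE sE.
have WE : [set j : 'I_n | (j < c.+1)%N && (ncell s1 2 j != 0%N)] =
    [set j : 'I_n | (j < c.+1)%N && W j].
  by apply/setP => j; rewrite !inE; case: (ltnP j c.+1) => //= jc; rewrite wE.
rewrite /=; split=> /=; rewrite /upd /=.
- by move=> x j x2 x5; rewrite (negbTE x2) /= nE.
- by split=> // j; rewrite rE.
- by rewrite -WE.
- congr f; apply/setP => j; rewrite !inE nE // vE.
  case: (ltnP j c.+1) => //= jc; case: (altP (j =P v :> nat)) => //= _.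
  by rewrite wE.
- by lia.
Qed.

Lemma tested_gain (X : {set 'I_n}) c (v : 'I_n) st st' :
  tested (fun j => (ncell st 1 j != 0%N) && (rcell st 0 j < rcell st 0 v)) c v st st' ->
  (v <= c)%N -> (forall j : 'I_n, j \in X -> (j <= c)%N) ->
  (forall j : 'I_n, (ncell st 1 j != 0%N) = (j \in X)) ->
  (forall j, (j <= c)%N -> rcell st 0 j = tape j) ->
  beval st' gain = (0 < marginal f v (below (key_lt tape) X v)).
Proof.
move=> [_ _ r1 r2 _] vc Xc XE kE; rewrite /= r1 r2 -ltNge /marginal subr_gt0.
have E : below (key_lt tape) X v = [set j : 'I_n | (j < c.+1)%N &&
    ((ncell st 1 j != 0%N) && (rcell st 0 j < rcell st 0 v))].
  apply/setP => j; rewrite !inE XE ltnS; case: (boolP (j \in X)) => jX /=;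
    last by rewrite andbF.
  by rewrite Xc // !kE // Xc.
rewrite E; congr (_ < f _); apply/setP => j; rewrite !inE -val_eqE.
by case: eqP => [->|//]; rewrite ltnS vc.
Qed.

Variables (a b : nat).
Let mark : pred nat := fun j => tape j < a%:R / b%:R.
Local Notation W i := (accepted f (key_lt tape) mark i).
Local Notation S i := (kept f (key_lt tape) mark i).

(** The invariant between arrivals. Array 0 is specified on arrived elements, which are the ones
    read out. *)
Definition simulates i st :=
  [/\ ncell st 3 0 = i, drawn st = i,
      forall j, (j < i)%N -> rcell st 0 j = tape j,
      forall j : 'I_n, (ncell st 1 j != 0%N) = (j \in W i) &
      forall j : 'I_n, (j < i)%N -> (ncell st 0 j != 0%N) = (j \in S i)].

Lemma exec_greedy_prog c st : (c < n)%N -> simulates c st ->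
  let st' := exec (oracle c) tape (greedy_prog a b) st in
  simulates c.+1 st' /\ (steps st' <= steps st + 100 * (c.+2 * c.+2))%N.
Proof.
move=> cn [cE dE kE WE _] st'.
have W_le i (j : 'I_n) : j \in W i -> (j < i)%N by rewrite accepted_mem => /andP[].
rewrite {}/st' /greedy_prog 5!exec_seq.
set s0 := exec _ _ (NSet 4 _ _) _.
have [s0n [s03 s04] s0d s0k s0s] : [/\ forall x j, x != 4 -> ncell s0 x j = ncell st x j,
    ncell s0 3 0 = c /\ ncell s0 4 0 = c, drawn s0 = c.+1,
    forall j, (j <= c)%N -> rcell s0 0 j = tape j & (steps s0 <= steps st + 10)%N].
  split; rewrite /= /upd /= ?cE ?dE //; last by lia.
    by move=> x j x4; rewrite (negbTE x4).
  by move=> j jc; case: eqP => // [->//|/eqP jn]; rewrite kE // ltn_neqAle jn.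
clearbody s0; have := exec_marginal_test s03 s04 (leqnn c).
move: (exec _ _ marginal_test s0) => s1 t1.
have g1 := @tested_gain (W c) c (Ordinal cn) _ _ t1 (leqnn c)
  (fun j h => ltnW (W_le c j h)) _ s0k.
have {}g1 := g1 (fun j => etrans (congr1 (fun x => x != 0%N) (s0n 1 j isT)) (WE j)).
have [s1n [s1r s1d] _ _ s1s] := t1.
rewrite exec_if.
have -> : beval s1 (BAnd gain (BNot (BRle (RDiv (RNat (NConst a)) (RNat (NConst b)))
      (RCell 0 (NCell 3 (NConst 0)))))) = (Ordinal cn \in W c.+1).
  rewrite [LHS](_ : _ = beval s1 gain && mark c).
    by rewrite g1 accepted_mem /= ltnSn andbC.
  by congr andb; rewrite /= s1n // s03 s1r s0k // -ltNge.
set s2 := exec _ _ (if _ then _ else _) _.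
have [s2n s21 s2r s2d s2s] : [/\
    forall x j, x != 1 -> x != 2 -> x != 5 -> ncell s2 x j = ncell s0 x j,
    forall j : 'I_n, (ncell s2 1 j != 0%N) = (j \in W c.+1),
    forall j, (j <= c)%N -> rcell s2 0 j = tape j, drawn s2 = c.+1 &
    (steps s2 <= steps s1 + 30)%N].
  have Wc (j : 'I_n) : j != c :> nat -> (j \in W c.+1) = (j \in W c).
    move=> jc; rewrite (accepted_restrict f _ _ (leqnSn c)) [RHS]inE andb_idr //.
    by move=> /W_le; rewrite ltnS leq_eqVlt (negbTE jc).
  rewrite /s2; case: (boolP (Ordinal cn \in _)) => cW; split;
    rewrite /= /upd /= ?s1d ?s1n ?s03 //.
  - by move=> x j x1 x2 x5; rewrite (negbTE x1) s1n.
  - move=> j; case: (j =P c :> nat) => [jc|/eqP jc].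
      have -> : j = Ordinal cn by apply: val_inj.
      by rewrite cW.
    by rewrite s1n // s0n // WE Wc.
  - by move=> j jc; rewrite s1r s0k.
  - by lia.
  - by move=> x j x1 x2 x5; rewrite s1n.
  - move=> j; rewrite s1n // s0n // WE.
    have [jc|jc] := eqVneq (j : nat) c; last by rewrite Wc.
    rewrite (_ : j = Ordinal cn); last exact: val_inj.
    by rewrite (negbTE cW) accepted_mem /= ltnn.
  - by move=> j jc; rewrite s1r s0k.
  - by lia.
clearbody s2.
set loop := For 4 _ _.
(* After [k] rounds the first [k] entries of the solution are final. One round costs a marginal
   test, linear in [c], so an arrival costs quadratic time. *)
pose J k s := [/\ ncell s 3 0 = c /\ drawn s = c.+1,
  forall j, (j <= c)%N -> rcell s 0 j = tape j,
  forall j : 'I_n, (ncell s 1 j != 0%N) = (j \in W c.+1),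
  forall j : 'I_n, (j < k)%N -> (ncell s 0 j != 0%N) = (j \in S c.+1) &
  (steps s <= steps s2 + 10 + (40 * c.+2 + 20) * k)%N].
have [] : J c.+1 (exec (oracle c) tape loop s2).
  have s23 : ncell s2 3 0 = c by rewrite s2n.
  have Ec : neval s2 (NAdd (NCell 3 (NConst 0)) (NConst 1)) = c.+1.
    by rewrite /= s23 addn1.
  rewrite -[X in J X _]Ec.
  apply: exec_for => [|k s kc [[nE dsE] kE' WE' SE sE]].
    by split=> //=; lia.
  have {}kc : (k <= c)%N by move: kc; rewrite Ec.
  rewrite exec_seq; set sk := tick 1 (nset 4 0 k s).
  have kn : (k < n)%N by exact: (leq_ltn_trans kc cn).
  have sk3 : ncell sk 3 0 = c by rewrite /= /upd /= nE.
  have sk4 : ncell sk 4 0 = k by rewrite /= /upd /=.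
  have := exec_marginal_test sk3 sk4 kc; move: (exec _ _ marginal_test sk) => s' t.
  have g := @tested_gain (W c.+1) c (Ordinal kn) _ _ t kc
    (fun j h => W_le c.+1 j h) WE' kE'.
  have [s'n [s'r s'd] _ _ s's] := t.
  rewrite exec_if.
  have -> : beval s' (BAnd gain (BNle (NConst 1) (NCell 1 (NCell 4 (NConst 0))))) =
      (Ordinal kn \in S c.+1).
    rewrite [LHS](_ : _ = beval s' gain && (ncell s 1 k != 0%N)).
      by rewrite g (WE' (Ordinal kn)) andbC [RHS]in_set.
    by congr andb; rewrite /= !s'n // /sk /= /upd /= -lt0n.
  have -> : (if Ordinal kn \in S c.+1 then NSet 0 (NCell 4 (NConst 0)) (NConst 1)
      else NSet 0 (NCell 4 (NConst 0)) (NConst 0)) =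
      NSet 0 (NCell 4 (NConst 0)) (NConst (Ordinal kn \in S c.+1)).
    by case: (Ordinal kn \in _).
  split; rewrite /= /upd /= ?s'n // /sk /= /upd /=.
  - by rewrite s'd.
  - by move=> j jc; rewrite s'r /= kE'.
  - by move=> j; rewrite s'n //= /upd /= WE'.
  - move=> j; rewrite ltnS leq_eqVlt; case: eqP => [jk _|_ /= jk].
      by rewrite (_ : j = Ordinal kn); [case: (Ordinal kn \in _)|apply: val_inj].
    by rewrite s'n //= /upd /= SE.
  - by move: s's; rewrite /sk /=; lia.
move: (exec _ _ loop s2) => s3 [s33 s3d] s3k s3W s3S s3s; split.
  split; rewrite /= /upd /= ?s33 ?addn1 //.
move=> /=; nia.
Qed.

Lemma run_greedy_prog i : (i <= n)%N ->
  let st := run (greedy_prog a b) f tape i in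
  simulates i st /\ (steps st <= i * (100 * (n.+1 * n.+1)))%N.
Proof.
elim: i => [_|i IH i_n]; first by split=> //; split=> // j; rewrite accepted_mem.
have [sim le_i] := IH (ltnW i_n); have [sim' le_Si] := exec_greedy_prog i_n sim.
split=> //; apply: leq_trans le_Si (leq_trans (leq_add le_i (leqnn _)) _).
by rewrite (mulSn i) [leqRHS]addnC leq_add2l leq_mul2l /= leq_mul.
Qed.

End Execution.

(** The revealed values form an instance with exactly [i] elements, so the simulation applies with
    [n = i]. *)
Lemma algorithm_of_greedy_prog (R : realType) (a b i : nat)
    (v : {set 'I_i} -> R) (tape : nat -> R) :
  algorithm_of (greedy_prog a b) v tape = threshold_greedy (a%:R / b%:R) v tape.
Proof.
have [[_ _ _ _ kE] _] := run_greedy_prog v tape a b (leqnn i).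
by apply/setP => j; rewrite [LHS]inE kE.
Qed.

Lemma polynomial_time_greedy_prog (R : realType) (a b : nat) :
  polynomial_time R (greedy_prog a b).
Proof.
exists ('X * (100%:P * (('X + 1) * ('X + 1))))%R => n f _ _ tape _.
have [_ /leq_trans-> //] := run_greedy_prog f tape a b (leqnn n).
by rewrite !hornerE -[n.+1]addn1.
Qed.

(** * Choice of the threshold *)

Theorem theorem1p2 (R : realType) :
  (exists A : online_algorithm R, competitive (1 / expR 1) A) /\
  (forall eps : R, 0 < eps ->
     exists p : prog,
       polynomial_time R p /\
       competitive (1 / expR 1 - eps) (algorithm_of p)).
Proof.
have e1 : 1 < expR 1 :> R by rewrite expR_gt1.
have e0 : 0 < expR 1 :> R by apply: expR_gt0.
have ie0 : 0 < (expR 1)^-1 :> R by rewrite invr_gt0.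
have ie1 : (expR 1)^-1 < 1 :> R by rewrite invf_lt1.
rewrite div1r; split.
  exists (threshold_greedy (1 - (expR 1)^-1)).
  apply: (@competitive_threshold_greedy _ (1 - (expR 1)^-1)) => //; first by lra.
  by rewrite opprB addrC subrK lnV ?posrE // expRK opprK mulr1.
move=> eps eps0.
(* The fraction [a / b] approximates [1 - 1 / e] from below with error [t] at most [1 / b], and [b]
   exceeds [e / eps], so that [e t <= eps]. *)
pose b := (Num.bound (expR 1 / eps)).+1.
pose a := Num.truncn (b%:R * (1 - (expR 1)^-1) : R).
have b0 : 0 < b%:R :> R by rewrite ltr0n.
have bE : expR 1 / eps < b%:R.
  apply: lt_trans (archi_boundP _) _; first by rewrite divr_ge0 // ltW.
  by rewrite ltr_nat.
have x0 : 0 <= b%:R * (1 - (expR 1)^-1) :> R by rewrite mulr_ge0 // subr_ge0 ltW.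
have /andP[ab ba] := truncn_itv x0; rewrite -/a in ab ba.
exists (greedy_prog a b); split; first exact: polynomial_time_greedy_prog.
apply: (@competitive_threshold_greedy _ (a%:R / b%:R)) => [||i v tape]; last first.
- exact: algorithm_of_greedy_prog.
- pose t : R := 1 - a%:R / b%:R - (expR 1)^-1.
  have qE : 1 - a%:R / b%:R = (expR 1)^-1 + t by rewrite /t; lra.
  have t0 : 0 <= t.
    suff : a%:R / b%:R <= 1 - (expR 1)^-1 :> R by rewrite /t; lra.
    by rewrite ler_pdivrMr // mulrC.
  have tb : t * b%:R <= 1.
    rewrite /t !mulrBl mul1r divfK ?lt0r_neq0 //.
    by move: ba; rewrite -natr1; lra.
  have b1 : 1 <= b%:R :> R by rewrite ler1n.
  have t1 : t <= 1 by apply: le_trans tb; rewrite ler_peMr.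
  have teps : expR 1 * t <= eps.
    rewrite -(ler_pM2r b0) -mulrA; apply: le_trans (ler_wpM2l (ltW e0) tb) _.
    by rewrite mulr1 mulrC -ler_pdivrMr // ltW.
  have q0 : 0 < (expR 1)^-1 + t by lra.
  (* Factoring out [1 / e] leaves [ln (1 + e t) - 1], and [ln (1 + x) <= x]. *)
  have lnq : ln ((expR 1)^-1 + t) <= expR 1 * t - 1.
    have -> : (expR 1)^-1 + t = (expR 1)^-1 * (1 + expR 1 * t).
      by rewrite mulrDr mulr1 mulrA mulVf ?mul1r // lt0r_neq0.
    have et0 : 0 <= expR 1 * t by rewrite mulr_ge0 // ltW.
    rewrite lnM ?posrE ?ltr_pwDl // lnV ?posrE // expRK.
    have := @le_ln1Dx R (expR 1 * t); lra.
  rewrite qE; apply: (@le_trans _ _ (((expR 1)^-1 + t) * (1 - expR 1 * t))); last first.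
    by rewrite ler_wpM2l ?(ltW q0) //; lra.
  (* The linear terms cancel; the remaining loss [e t t] is at most [e t] because [t <= 1]. *)
  have -> : ((expR 1)^-1 + t) * (1 - expR 1 * t) = (expR 1)^-1 - expR 1 * t * t.
    by field; rewrite lt0r_neq0.
  rewrite lerD2l lerN2; apply: le_trans teps.
  by rewrite ler_piMr // mulr_ge0 // ltW.
rewrite divr_ge0 //= ltr_pdivrMr // mul1r (le_lt_trans ab) //.
by rewrite -subr_gt0 -{1}[b%:R]mulr1 -mulrBr mulr_gt0 // subKr.
Qed.
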